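(* Let $m\ge 1$ and let $\mathcal{U}$ be an open subset of $\mathbb{C}\mathbb{E}^{2m+1}$. A totally co-geodetic null structure on $\mathcal{U}$ gives rise to an $m$-dimensional complex submanifold of $\underline{\widehat{\mathcal{U}}}\subset\mathbb{MT}$ intersecting $\underline{\hat{x}}\subset\underline{\widehat{\mathcal{U}}}$ transversely for each $x\in\mathcal{U}$. Conversely, any totally co-geodetic null structure locally arises in this way.
   Context: Everything is holomorphic. $\mathbb{C}\mathbb{E}^{2m+1}$ is complex Euclidean space, i.e. $\mathbb{C}^{2m+1}$ with its flat holomorphic metric $g$ and flat Levi-Civita connection $\nabla$. A co-$\gamma$-plane is an $(m+1)$-dimensional affine subspace of $\mathbb{C}\mathbb{E}^{2m+1}$ such that the orthogonal complement of its tangent space (at any of its points) is totally null with respect to $g$. The mini-twistor space $\mathbb{MT}$ is the space of all co-$\gamma$-planes in $\mathbb{C}\mathbb{E}^{2m+1}$; it is a complex manifold of dimension $\frac12 m(m+3)$. For $x\in\mathbb{C}\mathbb{E}^{2m+1}$, $\underline{\hat{x}}\subset\mathbb{MT}$ denotes the complex submanifold of dimension $\frac12 m(m+1)$ consisting of all co-$\gamma$-planes through $x$, and $\underline{\widehat{\mathcal{U}}}:=\bigcup_{x\in\mathcal{U}}\underline{\hat{x}}$. An almost null structure on $\mathcal{U}$ is a holomorphic rank-$m$ distribution $N\subset \mathrm{T}\mathcal{U}$ that is totally null with respect to $g$; $N^\perp\supset N$ is its rank-$(m+1)$ orthogonal complement. $N$ is totally co-geodetic if $\nabla_Y X\in\Gamma(N^\perp)$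 for all $X,Y\in\Gamma(N^\perp)$ (local holomorphic sections); this implies that $N$ is integrable (hence a null structure, i.e. an integrable almost null structure) and that $N^\perp$ is integrable. Meaning of ''gives rise to'' and ''arises'' (the statement is local on $\mathcal{U}$, i.e. $\mathcal U$ may be shrunk around a given point): the leaves of $N^\perp$ are open pieces of co-$\gamma$-planes, and the submanifold $\underline{\mathcal{W}}\subset\mathbb{MT}$ attached to $N$ consists of these co-$\gamma$-planes (the leaf space of $N^\perp$). Conversely, an $m$-dimensional complex submanifold $\underline{\mathcal{W}}$ of $\underline{\widehat{\mathcal{U}}}$ meeting each $\underline{\hat{x}}$, $x\in\mathcal{U}$, transversely in a point defines $N^\perp_x$ as the tangent space at $x$ of the corresponding co-$\gamma$-plane, and $N=(N^\perp)^\perp$ is a totally co-geodetic null structure. *)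

(* Defs.v *)
From HB Require Import structures.
From mathcomp Require Import all_boot all_order all_algebra.
From mathcomp Require Import complex.
From mathcomp Require Import all_classical all_reals all_analysis.

Set Implicit Arguments.
Unset Strict Implicit.
Unset Printing Implicit Defensive.

Import Order.TTheory GRing.Theory Num.Theory.
Import numFieldNormedType.Exports.

Local Open Scope classical_set_scope.
Local Open Scope ring_scope.
Local Open Scope complex_scope.

(* The complex numbers over R, kept folded so that the topology and the normed *)
(* module structures of an abstract numFieldType apply to them.                *)
Definition Cplx (R : realType) : numClosedFieldType := R[i].

Section Holomorphic.
Variable R : realType.
Local Notation C := (Cplx R).

(* Holomorphic maps are C^1 maps whose Frechet differential is C-linear: here  *)
(* differentiable is differentiability over the scalar field Cplx R.           *)
(* By Goursat-Osgood the continuity clause follows from the first one when E   *)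
(* and F are finite-dimensional. Only meaningful for open O.                   *)
Definition holomorphic_on (E F : normedModType C) (O : set E) (f : E -> F) :=
  forall x, O x ->
    differentiable f x /\
    forall v : E, {for x, continuous (fun y => 'd f y v)}.

Section Matrices.
Variables p q : nat.
Local Notation E := 'M[C]_(p, q).

(* Slice charts: near each of its points S is the preimage of a d-dimensional  *)
(* linear subspace under a biholomorphic map Phi : O -> O' of open subsets.    *)
Definition complex_submanifold (d : nat) (S : set E) :=
  forall a, S a ->
    exists O O' : set E, exists Phi Psi : E -> E, exists F : {vspace E},
      [/\ open O, O a, open O', holomorphic_on O Phi & holomorphic_on O' Psi] /\
      [/\ (forall z, O z -> O' (Phi z) /\ Psi (Phi z) = z),
          (forall w, O' w -> O (Psi w) /\ Phi (Psi w) = w),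
          \dim F = d
        & forall z, O z -> (S z <-> Phi z \in F)].

(* For a complex submanifold S this is the holomorphic tangent space at a.     *)
Definition tangent_vectors (S : set E) (a : E) : set E :=
  [set v | exists (O : set C^o) (c : C^o -> E),
     [/\ open O, O 0, holomorphic_on O c, c 0 = a & forall t, O t -> S (c t)]
     /\ derive1 c 0 = v].

End Matrices.
End Holomorphic.

Section ComplexEuclideanSpace.
Variables (R : realType) (m : nat).
Local Notation C := (Cplx R).
Local Notation V := 'rV[C]_(2 * m).+1.

Definition g (u v : V) : C := (u *m v^T) 0 0.

Fact g_linear_l (u : V) : linear_for *%R (g ^~ u : V -> C).
Proof. by move=> a x y; rewrite /g mulmxDl -scalemxAl !mxE. Qed.

Fact g_linear_r (u : V) : linear_for (idfun \; *%R) (g u : V -> C).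
Proof. by move=> a x y; rewrite /g linearP /= mulmxDr -scalemxAr !mxE. Qed.

HB.instance Definition _ :=
  bilinear_isBilinear.Build C V V C
    (GRing.Scale.Law.clone _ _ *%R _) (GRing.Scale.Law.clone _ _ (idfun \; *%R) _)
    g (g_linear_l, g_linear_r).

Fact g_sym (u v : V) : g u v = (-1) ^+ false * idfun (g v u).
Proof. by rewrite expr0 mul1r /= /g -[u *m v^T]trmxK trmx_mul trmxK mxE. Qed.

HB.instance Definition _ :=
  isHermitianSesquilinear.Build C V false idfun g g_sym.

Definition perp (W : {vspace V}) : {vspace V} := orthov g W.

Lemma perpP (W : {vspace V}) (u : V) :
  reflect (forall v, v \in W -> g u v = 0) (u \in perp W).
Proof. exact: mem_orthovP. Qed.

Definition totally_null (W : {vspace V}) :=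
  forall u v, u \in W -> v \in W -> g u v = 0.

Definition affine_subspace (x : V) (T : {vspace V}) : set V :=
  [set y | y - x \in T].

(* The mini-twistor space MT; co-gamma-planes are point sets of V. *)
Definition MT : set (set V) :=
  [set S | exists x T, [/\ S = affine_subspace x T, \dim T = m.+1
                         & totally_null (perp T)]].

Definition planes_through (x : V) : set (set V) := [set S | MT S /\ S x].

Definition planes_meeting (U : set V) : set (set V) :=
  \bigcup_(x in U) planes_through x.

(* Complex structure on MT. If the columns of (P | Q) form a basis of the dual *)
(* of V, then y |-> (s, t) = (yP, yQ) are linear coordinates on V, and the     *)
(* (m+1)-dimensional affine subspaces that are graphs t = s A + b are          *)
(* parametrised by the matrix M with rows A, b. Over all (P | Q), these M form *)
(* the standard holomorphic atlas of the affine Grassmannian of (m+1)-planes   *)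
(* in V, of which MT is a closed complex submanifold. Submanifolds of MT and   *)
(* tangent spaces are computed in these charts.                                *)
Definition chart (P : 'M[C]_((2 * m).+1, m.+1)) (Q : 'M[C]_((2 * m).+1, m)) :=
  row_free (row_mx P Q).

Definition chart_plane (P : 'M[C]_((2 * m).+1, m.+1))
    (Q : 'M[C]_((2 * m).+1, m)) (M : 'M[C]_(m.+1 + 1, m)) : set V :=
  [set y | y *m Q = row_mx (y *m P) 1%:M *m M].

Definition in_chart P Q (W : set (set V)) : set 'M[C]_(m.+1 + 1, m) :=
  [set M | W (chart_plane P Q M)].

Definition submanifold_of_MT (d : nat) (W : set (set V)) :=
  W `<=` MT /\ forall P Q, chart P Q -> complex_submanifold d (in_chart P Q W).

(* T_S MT = T_S W1 + T_S W2, the other inclusion being trivial for W1, W2      *)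
(* contained in MT.                                                            *)
Definition transverse_at (W1 W2 : set (set V)) (S : set V) :=
  forall P Q M, chart P Q -> chart_plane P Q M = S ->
  forall v, tangent_vectors (in_chart P Q MT) M v ->
  exists v1 v2, [/\ tangent_vectors (in_chart P Q W1) M v1,
                    tangent_vectors (in_chart P Q W2) M v2 & v = v1 + v2].

(* Distributions are only constrained on the open set U under consideration.   *)
Definition holomorphic_distribution (U : set V) (k : nat) (D : V -> {vspace V}) :=
  (forall x, U x -> \dim (D x) = k) /\
  forall x, U x -> exists (O : set V) (X : 'I_k -> V -> V),
    [/\ open O, O x, O `<=` U, forall i, holomorphic_on O (X i)
      & forall y, O y -> D y = <<[seq X i y | i <- enum 'I_k]>>%VS].

Definition local_section (D : V -> {vspace V}) (O : set V) (X : V -> V) :=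
  holomorphic_on O X /\ forall x, O x -> X x \in D x.

(* nabla X Y is the covariant derivative of Y along X for the flat connection. *)
Definition nabla (X Y : V -> V) : V -> V := fun x => 'D_(X x) Y x.

Definition lie_bracket (X Y : V -> V) : V -> V :=
  fun x => nabla X Y x - nabla Y X x.

Definition almost_null_structure (U : set V) (N : V -> {vspace V}) :=
  holomorphic_distribution U m N /\ forall x, U x -> totally_null (N x).

Definition integrable (U : set V) (D : V -> {vspace V}) :=
  forall (O : set V) X Y, open O -> O `<=` U ->
    local_section D O X -> local_section D O Y ->
    forall x, O x -> lie_bracket X Y x \in D x.

Definition null_structure (U : set V) (N : V -> {vspace V}) :=
  almost_null_structure U N /\ integrable U N.

Definition ortho_dist (N : V -> {vspace V}) : V -> {vspace V} :=
  fun x => perp (N x).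

Definition totally_co_geodetic (U : set V) (N : V -> {vspace V}) :=
  forall (O : set V) X Y, open O -> O `<=` U ->
    local_section (ortho_dist N) O X -> local_section (ortho_dist N) O Y ->
    forall x, O x -> nabla Y X x \in ortho_dist N x.

Definition totally_co_geodetic_null_structure (U : set V) N :=
  null_structure U N /\ totally_co_geodetic U N.

(* x and y lie on a common holomorphic disc in U tangent to D. *)
Definition integral_disc (U : set V) (D : V -> {vspace V}) (x y : V) :=
  exists (a r : C) (c : C^o -> V),
    [/\ holomorphic_on (ball (a : C^o) r) c,
        forall t, ball (a : C^o) r t -> U (c t) /\ derive1 c t \in D (c t)
      & exists s t, [/\ ball (a : C^o) r s, ball (a : C^o) r t, c s = x & c t = y]].

(* The leaf of D in U through x, as the set of points joined to x by a chain   *)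
(* of integral discs; for an integrable D of constant rank this is the maximal *)
(* connected integral manifold through x.                                      *)
Inductive leaf (U : set V) (D : V -> {vspace V}) (x : V) : V -> Prop :=
| leaf_refl : leaf U D x x
| leaf_step y z : leaf U D x y -> integral_disc U D y z -> leaf U D x z.

Definition open_piece (L S : set V) := exists O : set V, open O /\ L = S `&` O.

Definition leaf_planes (U : set V) (N : V -> {vspace V}) : set (set V) :=
  [set S | MT S /\
           exists2 x, U x & open_piece (leaf U (ortho_dist N) x) S].

Definition transverse_family (U : set V) (W : set (set V)) :=
  [/\ W `<=` planes_meeting U, submanifold_of_MT m W
    & forall x, U x -> exists S, W `&` planes_through x = [set S]
                                 /\ transverse_at W (planes_through x) S].

(* N is the structure attached to W: for x in U the tangent space at x of the  *)
(* member of W through x is the orthogonal complement of N x. This determines  *)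
(* N on U when transverse_family U W holds.                                    *)
Definition attached (U : set V) (W : set (set V)) (N : V -> {vspace V}) :=
  forall x S, U x -> W S -> S x -> S = affine_subspace x (ortho_dist N x).

End ComplexEuclideanSpace.

(* Main.v *)
Require Import Defs.
From HB Require Import structures.
From mathcomp Require Import all_boot all_order all_algebra.
From mathcomp Require Import complex.
From mathcomp Require Import all_classical all_reals all_analysis.
From mathcomp Require Import lra ring.

(** Write D for the orthogonal complement of N.  Everything rests on describing D
by graphs.  If the columns of (P | Q) are linear coordinates on V in which D x
projects isomorphically along the first ones, then D x is the graph
v Q = v P (A x) for a unique matrix A x, and A is holomorphic because it is a
rational expression in a local frame of N (local_graph).

From a null structure to a submanifold.  The rows of the graph matrix of A are
sections of D, so co-geodesy says exactly that the derivative of A vanishes on D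
(graph_derivative0).  Moving from y inside the plane y + D y, the direction of
motion differs from a vector of D by the variation of A itself; hence A varies at
most at a small multiple of its own variation, which on a small ball forces it to
be constant (graph_constant).  No differential equation is solved.  So D is
constant along its own planes, the leaves of D in the ball are the traces of
these planes (leaf_plane), and two planes meeting in the ball coincide.

In a chart, planes are pairs (A', b).  Fix x; the plane of (A', b) contains the
point z whose first coordinates are those of x and whose last coordinates are
tau = x P A' + b.  The plane therefore belongs to the family if and only if
A' = A z, and the family is the graph of the holomorphic map tau |-> A (z tau).
This yields slice charts without any implicit function theorem
(plane_submanifold).  For transversality, a tangent vector of the mini-twistor
space at such a point is split into the velocity of that graph with the same
tau-component and a remainder fixing x.  The remainder satisfies the linearised
isotropy equation, and a Cayley transform of a skew matrix integrates it to a
curve of co-gamma-planes through x (isotropic_curve, plane_transverse).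

From a submanifold to a null structure.  Let T x be the direction of the unique
member through x.  Near a given point the submanifold is parametrised by m
complex parameters p, and incidence of x with the plane of parameter p is a
system of m equations.  Transversality makes the derivative in p of this system
onto, hence invertible (incidence_onto), so the inverse function theorem
(local_right_inverse, by Picard iteration) produces a member through each nearby
x depending holomorphically on x; by uniqueness it is the given one, and T is
locally the graph of a holomorphic A (family_graph).  Uniqueness also makes T
constant along the planes.  Sections of T, or of its orthogonal complement, then
have derivatives along T in the same space, which gives both co-geodesy and
integrability (derivative_along_plane, attached_structure). *)

Set Implicit Arguments.
Unset Strict Implicit.
Unset Printing Implicit Defensive.
Import Order.TTheory GRing.Theory Num.Theory.
Import numFieldNormedType.Exports.
Local Open Scope classical_set_scope.
Local Open Scope ring_scope.
Local Open Scope complex_scope.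

(** * Differentials of vector- and matrix-valued maps *)

Section Differentials.
Variable K : numFieldType.
Implicit Types E F G : normedModType K.

Lemma linear_mx_delta p q (F : lmodType K) (f : {linear 'M[K]_(p, q) -> F}) M :
  f M = \sum_i \sum_j M i j *: f (delta_mx i j).
Proof.
rewrite {1}[M]matrix_sum_delta linear_sum; apply: eq_bigr => i _.
by rewrite linear_sum; apply: eq_bigr => j _; rewrite linearZ.
Qed.

Lemma linear_mx_deltaB p q (F : lmodType K) (f h : {linear 'M[K]_(p, q) -> F}) M :
  f M - h M = \sum_i \sum_j M i j *: (f (delta_mx i j) - h (delta_mx i j)).
Proof.
rewrite (linear_mx_delta f) (linear_mx_delta h) -sumrB; apply: eq_bigr => i _.
by rewrite -sumrB; apply: eq_bigr => j _; rewrite scalerBr.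
Qed.

(** Expand in matrix units: a linear map out of a space of matrices is a finite sum of
continuous maps. *)
Lemma continuous_linear_mx p q F (f : {linear 'M[K]_(p, q) -> F}) :
  continuous f.
Proof.
have -> : (f : _ -> _) = \sum_(i < p) \sum_(j < q) (fun M : 'M[K]_(p, q) => M i j *: f (delta_mx i j)).
  apply/funext => M; rewrite linear_mx_delta fct_sumE.
  by apply: eq_bigr => i _; rewrite fct_sumE.
have csum (I : finType) (h : I -> 'M[K]_(p, q) -> F) :
    (forall i, continuous (h i)) -> continuous (\sum_i h i).
  move=> ch; elim/big_ind: _ => [||i _]; last exact: ch.
    by move=> M; exact: cst_continuous.
  by move=> h1 h2 c1 c2 M; apply: continuousD; [exact: c1 | exact: c2].
apply: (csum 'I_p) => i; apply: (csum 'I_q) => j M.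
apply: (continuous_comp (f := fun M : 'M[K]_(p,q) => M i j)
  (g := fun z : K => z *: f (delta_mx i j))).
  exact: coord_continuous.
exact: scalel_continuous.
Qed.

Lemma is_diff_linear_mx p q F (f : {linear 'M[K]_(p, q) -> F}) M :
  is_diff M f f.
Proof.
have fc := @continuous_linear_mx p q F f.
by apply: DiffDef; [exact: linear_differentiable | rewrite diff_lin].
Qed.

Lemma differentiable_entry E p q (f : E -> 'M[K]_(p, q)) x i j :
  differentiable f x -> differentiable (fun y => f y i j : K) x.
Proof. by move=> df; apply: differentiable_comp df (differentiable_coord _ _ _). Qed.

Lemma diff_entry E p q (f : E -> 'M[K]_(p, q)) x i j v :
  differentiable f x -> 'd (fun y => f y i j : K) x v = 'd f x v i j.
Proof.
move=> df.
have lc : linear (fun M : 'M[K]_(p, q) => M i j : K) by move=> a A B; rewrite !mxE.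
pose cM := GRing.isLinear.Build _ _ _ _ _ lc.
pose c : {linear _ -> _} := HB.pack (fun M : 'M[K]_(p, q) => M i j : K) cM.
have -> : (fun y => f y i j : K) = c \o f by [].
have [dc ec] := is_diff_linear_mx c (f x).
by rewrite diff_comp //= ec.
Qed.

Lemma differentiable_mx E p q (f : E -> 'M[K]_(p, q)) x :
  (forall i j, differentiable (fun y => f y i j : K) x) -> differentiable f x.
Proof.
move=> df.
have -> : f = \sum_(i < p) \sum_(j < q) (fun y => f y i j *: delta_mx i j).
  apply/funext => y; rewrite [f y in LHS]matrix_sum_delta fct_sumE.
  by apply: eq_bigr => i _; rewrite fct_sumE.
apply: differentiable_sum => i; apply: differentiable_sum => j.
by apply: differentiableZl.
Qed.

(** A map vanishing near a point is its own little-o remainder. *)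
Lemma near0_differentiable E F (h : E -> F) x :
  (\forall y \near x, h y = 0) -> differentiable h x /\ 'd h x = 0 :> (E -> F).
Proof.
move=> h0.
have h00 : h x = 0 := nbhs_singleton h0.
have H : h \o shift x = cst (h x) + (\0 : {linear E -> F}) +o_ 0 id.
  apply/eqaddoE.
  have o0 : h \o shift x =o_ 0 id.
    apply/eqoP => e e0.
    have := h0; rewrite (near_shift 0 x) subr0 => h0'.
    near=> y; rewrite /= (_ : h (y + x) = 0) ?normr0 ?mulr_ge0 // ?ltW //.
    exact: (near h0' y).
  rewrite h00; apply/funext => y; rewrite !fctE add0r /= add0r.
  by rewrite -[LHS]/((h \o shift x) y) {1}o0.
have c0 : continuous (\0 : {linear E -> F}) by move=> y; exact: cst_continuous.
have e0 := diff_unique c0 H.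
split; last by rewrite e0.
apply/diff_locallyP; rewrite e0; split => //.
Unshelve. all: by end_near. Qed.

Lemma diffD_apply E F (f h : E -> F) x v :
  differentiable f x -> differentiable h x ->
  'd (fun y => f y + h y) x v = 'd f x v + 'd h x v.
Proof. by move=> df dh; exact: (congr1 (@^~ v) (diffD df dh)). Qed.

Lemma diffN_apply E F (f : E -> F) x v :
  differentiable f x -> 'd (fun y => - f y) x v = - 'd f x v.
Proof. by move=> df; exact: (congr1 (@^~ v) (diffN df)). Qed.

Lemma diffB_apply E F (f h : E -> F) x v :
  differentiable f x -> differentiable h x ->
  'd (fun y => f y - h y) x v = 'd f x v - 'd h x v.
Proof. by move=> df dh; exact: (congr1 (@^~ v) (diffB df dh)). Qed.

Lemma differentiable_idfun E (x : E) : differentiable (fun y : E => y) x.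
Proof. by case: (is_diff_id x). Qed.

Lemma diff_id_apply E (x v : E) : 'd (fun y : E => y) x v = v.
Proof. by case: (is_diff_id x) => _ /(congr1 (@^~ v)). Qed.

Lemma diff_linear_mx_apply p q F (f : {linear 'M[K]_(p, q) -> F}) M v :
  'd f M v = f v.
Proof. by case: (is_diff_linear_mx f M) => _ /(congr1 (@^~ v)). Qed.

Lemma diff_cst_apply E F (a : F) (x v : E) : 'd (fun=> a) x v = 0.
Proof. exact: (congr1 (@^~ v) (diff_cst a x)). Qed.

Lemma diffM_apply E (f h : E -> K) x v :
  differentiable f x -> differentiable h x ->
  'd (fun y => f y * h y) x v = f x * 'd h x v + h x * 'd f x v.
Proof. by move=> df dh; exact: (congr1 (@^~ v) (diffM df dh)). Qed.

Lemma diffV_apply E (f : E -> K) x v :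
  differentiable f x -> f x != 0 ->
  'd (fun y => (f y)^-1) x v = - ((f x)^-1 * (f x)^-1) * 'd f x v.
Proof.
move=> df f0; have := congr1 (@^~ v) (diffV df f0).
by rewrite -invfM -expr2.
Qed.

Lemma diff_comp_apply E F G (h : E -> F) (f : F -> G) x v :
  differentiable h x -> differentiable f (h x) ->
  'd (fun y => f (h y)) x v = 'd f (h x) ('d h x v).
Proof. by move=> dh df; exact: (congr1 (@^~ v) (diff_comp dh df)). Qed.

Lemma near_eq_diff E F (f h : E -> F) x :
  (\forall y \near x, f y = h y) -> differentiable f x ->
  differentiable h x /\ forall v, 'd h x v = 'd f x v.
Proof.
move=> fh df.
have [] := @near0_differentiable E F (h - f) x.
  by apply: filterS fh => y; rewrite !fctE => ->; rewrite subrr.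
move=> d0 e0; have -> : h = f + (h - f).
  by apply/funext => y; rewrite !fctE addrC subrK.
split; first exact: differentiableD.
move=> v; rewrite [LHS](diffD_apply v df d0).
by rewrite [X in _ + X](congr1 (@^~ v) e0) addr0.
Qed.

Lemma diff_mulmxr E p q r (f : E -> 'M[K]_(p, q)) (S : 'M[K]_(q, r)) x :
  differentiable f x ->
  differentiable (fun y => f y *m S) x /\
  forall v, 'd (fun y => f y *m S) x v = 'd f x v *m S.
Proof.
move=> df; pose g : {linear _ -> _} := mulmxr S : {linear 'M[K]_(p, q) -> 'M[K]_(p, r)}.
have dg : differentiable g (f x) by have [] := is_diff_linear_mx g (f x).
split; first exact: (differentiable_comp df dg).
by move=> v; rewrite [LHS](diff_comp_apply v df dg) diff_linear_mx_apply.
Qed.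

Lemma diff_mulmxl E p q r (f : E -> 'M[K]_(q, r)) (S : 'M[K]_(p, q)) x :
  differentiable f x ->
  differentiable (fun y => S *m f y) x /\
  forall v, 'd (fun y => S *m f y) x v = S *m 'd f x v.
Proof.
move=> df; pose g : {linear _ -> _} := mulmx S : {linear 'M[K]_(q, r) -> 'M[K]_(p, r)}.
have dg : differentiable g (f x) by have [] := is_diff_linear_mx g (f x).
split; first exact: (differentiable_comp df dg).
by move=> v; rewrite [LHS](diff_comp_apply v df dg) diff_linear_mx_apply.
Qed.

Lemma diff_mulmx E p q r (f : E -> 'M[K]_(p, q)) (h : E -> 'M[K]_(q, r)) x :
  differentiable f x -> differentiable h x ->
  differentiable (fun y => f y *m h y) x /\
  forall v, 'd (fun y => f y *m h y) x v = 'd f x v *m h x + f x *m 'd h x v.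
Proof.
move=> df dh.
have e i j : (fun y => (f y *m h y) i j : K) =
    \sum_k ((fun y => f y i k) * (fun y => h y k j)).
  by apply/funext => y; rewrite mxE fct_sumE.
have d i j : differentiable (fun y => (f y *m h y) i j : K) x.
  rewrite e; apply: differentiable_sum => k.
  by apply: differentiableM; apply: differentiable_entry.
split; first exact: differentiable_mx.
move=> v; apply/matrixP => i j; rewrite -diff_entry; last exact: differentiable_mx.
rewrite e !mxE -big_split /=.
have ds (I : Type) (s : seq I) (g : I -> E -> K) :
    (forall k, differentiable (g k) x) ->
    differentiable (\sum_(k <- s) g k) x /\
    'd (\sum_(k <- s) g k) x v = \sum_(k <- s) 'd (g k) x v.
  move=> dg; elim: s => [|k s [IH1 IH2]].
    rewrite !big_nil; split; first exact: (differentiable_cst (0 : K) x).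
    exact: (diff_cst_apply (0 : K) x v).
  rewrite !big_cons; split; first exact: differentiableD.
  by rewrite -IH2; exact: (diffD_apply v (dg k) IH1).
rewrite (ds _ _ _ _).2; last first.
  by move=> k; apply: differentiableM; apply: differentiable_entry.
apply: eq_bigr => k _.
rewrite [LHS](diffM_apply v (differentiable_entry _ _ df) (differentiable_entry _ _ dh)).
by rewrite (diff_entry i k v df) (diff_entry k j v dh) addrC; congr (_ + _); rewrite mulrC.
Qed.

End Differentials.

(** * Calculus of continuously differentiable maps *)

Section C1Maps.
Variable K : numFieldType.
Implicit Types E F G : normedModType K.

(** Continuous differentiability in the sense of Frechet; over [Cplx R] this is
[holomorphic_on]. *)
Definition C1_on E F (O : set E) (f : E -> F) :=
  forall x, O x -> differentiable f x /\ forall v, {for x, continuous (fun y => 'd f y v)}.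

(** The continuity clause may be checked on any formula for the derivative that is
valid on the open set [O]. *)
Lemma C1_formula E F (O : set E) (f : E -> F) (D : E -> E -> F) :
  open O -> (forall x, O x -> differentiable f x) ->
  (forall x v, O x -> 'd f x v = D x v) ->
  (forall x v, O x -> {for x, continuous (D^~ v)}) -> C1_on O f.
Proof.
move=> oO df dE cD x Ox; split; first exact: df.
move=> v; rewrite /prop_for /continuous_at dE //.
apply: (cvg_trans _ (cD x v Ox)); apply: near_eq_cvg.
by near=> y; rewrite dE //; near: y; exact: open_nbhs_nbhs.
Unshelve. all: by end_near. Qed.

Lemma C1_sub E F (O O1 : set E) (f : E -> F) :
  O1 `<=` O -> C1_on O f -> C1_on O1 f.
Proof. by move=> sO hf x /sO/hf. Qed.

Lemma C1_eq E F (O : set E) (f h : E -> F) :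
  open O -> (forall x, O x -> f x = h x) -> C1_on O f -> C1_on O h.
Proof.
move=> oO fh hf.
have nfh x : O x -> \forall y \near x, f y = h y.
  by move=> Ox; near=> y; apply: fh; near: y; exact: open_nbhs_nbhs.
apply: (C1_formula (D := fun x v => 'd f x v)) => // x.
- by move=> Ox; apply: (near_eq_diff (nfh x Ox) _).1; case: (hf x Ox).
- by move=> v Ox; apply: (near_eq_diff (nfh x Ox) _).2; case: (hf x Ox).
- by move=> v Ox; case: (hf x Ox).
Unshelve. all: by end_near. Qed.

Lemma C1_cst E F (O : set E) (a : F) :
  C1_on O (fun=> a).
Proof.
move=> x Ox; split; first exact: differentiable_cst.
move=> v; have -> : (fun y => 'd (fun=> a) y v) = fun=> 0.
  by apply/funext => y; rewrite (diff_cst a y).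
exact: cst_continuous.
Qed.

Lemma C1_linear E F (O : set E) (f : {linear E -> F}) :
  continuous f -> C1_on O f.
Proof.
move=> cf x Ox; split; first exact: linear_differentiable.
move=> v; have -> : (fun y => 'd f y v) = fun=> f v.
  by apply/funext => y; rewrite diff_lin.
exact: cst_continuous.
Qed.

Lemma C1_linear_mx p q F (O : set 'M[K]_(p, q))
  (f : {linear 'M[K]_(p, q) -> F}) : C1_on O f.
Proof. by apply: C1_linear; exact: continuous_linear_mx. Qed.

Lemma C1D E F (O : set E) (f h : E -> F) : open O ->
  C1_on O f -> C1_on O h -> C1_on O (fun x => f x + h x).
Proof.
move=> oO hf hh.
apply: (C1_formula (D := fun x v => 'd f x v + 'd h x v)) => // x.
- by move=> Ox; apply: differentiableD; [case: (hf x Ox)|case: (hh x Ox)].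
- move=> v Ox; have [df _] := hf x Ox; have [dh _] := hh x Ox.
  exact: diffD_apply.
- by move=> v Ox; apply: continuousD; [apply: (hf x Ox).2|apply: (hh x Ox).2].
Qed.

Lemma C1N E F (O : set E) (f : E -> F) : open O ->
  C1_on O f -> C1_on O (fun x => - f x).
Proof.
move=> oO hf.
apply: (C1_formula (D := fun x v => - 'd f x v)) => // x.
- by move=> Ox; apply: differentiableN; case: (hf x Ox).
- move=> v Ox; have [df _] := hf x Ox.
  exact: diffN_apply.
- by move=> v Ox; apply: continuousN; apply: (hf x Ox).2.
Qed.

Lemma C1B E F (O : set E) (f h : E -> F) : open O ->
  C1_on O f -> C1_on O h -> C1_on O (fun x => f x - h x).
Proof. by move=> oO hf hh; exact: (C1D oO hf (C1N oO hh)). Qed.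

Lemma C1_sum E F (O : set E) (I : Type) (r : seq I) (P : pred I)
    (f : I -> E -> F) : open O ->
  (forall i, C1_on O (f i)) ->
  C1_on O (fun x => \sum_(i <- r | P i) f i x).
Proof.
move=> oO hf; elim: r => [|i r IH].
  by under eq_fun do rewrite big_nil; exact: C1_cst.
under eq_fun do rewrite big_cons.
case: (P i); last exact: IH.
exact: (C1D oO (hf i) IH).
Qed.

Lemma C1M E (O : set E) (f h : E -> K) : open O ->
  C1_on O f -> C1_on O h ->
  C1_on O (fun x => f x * h x : K).
Proof.
move=> oO hf hh.
have cf x : O x -> {for x, continuous f}.
  by move=> Ox; apply: differentiable_continuous; case: (hf x Ox).
have ch x : O x -> {for x, continuous h}.
  by move=> Ox; apply: differentiable_continuous; case: (hh x Ox).
apply: (C1_formula (D := fun x v => f x * 'd h x v + h x * 'd f x v))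
  => // x.
- by move=> Ox; apply: differentiableM; [case: (hf x Ox)|case: (hh x Ox)].
- move=> v Ox; have [df _] := hf x Ox; have [dh _] := hh x Ox.
  exact: diffM_apply.
- move=> v Ox; apply: continuousD; apply: continuousM.
  + exact: cf.
  + exact: (hh x Ox).2.
  + exact: ch.
  + exact: (hf x Ox).2.
Qed.

Lemma C1_prod E (O : set E) (I : Type) (r : seq I) (P : pred I)
    (f : I -> E -> K) : open O ->
  (forall i, C1_on O (f i)) ->
  C1_on O (fun x => \prod_(i <- r | P i) f i x).
Proof.
move=> oO hf; elim: r => [|i r IH].
  by under eq_fun do rewrite big_nil; exact: C1_cst.
under eq_fun do rewrite big_cons.
case: (P i); last exact: IH.
exact: (C1M oO (hf i) IH).
Qed.

Lemma C1V E (O : set E) (f : E -> K) : open O ->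
  (forall x, O x -> f x != 0) ->
  C1_on O f -> C1_on O (fun x => (f x)^-1 : K).
Proof.
move=> oO f0 hf.
have cf x : O x -> {for x, continuous f}.
  by move=> Ox; apply: differentiable_continuous; case: (hf x Ox).
apply: (C1_formula (D := fun x v => - ((f x)^-1 * (f x)^-1) * 'd f x v))
  => // x.
- by move=> Ox; apply: differentiableV; [case: (hf x Ox)|exact: f0].
- move=> v Ox; have [df _] := hf x Ox.
  by apply: diffV_apply; rewrite ?f0.
- move=> v Ox; apply: continuousM; last exact: (hf x Ox).2.
  by apply: continuousN; apply: continuousM; apply: continuousV; rewrite ?f0 //; exact: cf.
Qed.

Lemma C1_entry E p q (O : set E) (f : E -> 'M[K]_(p, q)) i j :
  open O -> C1_on O f -> C1_on O (fun x => f x i j : K).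
Proof.
move=> oO hf.
apply: (C1_formula (D := fun x v => 'd f x v i j)) => // x.
- by move=> Ox; apply: differentiable_entry; case: (hf x Ox).
- by move=> v Ox; apply: diff_entry; case: (hf x Ox).
- move=> v Ox; apply: (@continuous_comp _ _ _ (fun x => 'd f x v) (fun M : 'M[K]_(p, q) => M i j)).
    exact: (hf x Ox).2.
  exact: coord_continuous.
Qed.

Lemma continuous_mx (T : topologicalType) p q (f : T -> 'M[K]_(p, q)) x :
  (forall i j, {for x, continuous (fun y => f y i j : K)}) -> {for x, continuous f}.
Proof.
move=> cf; apply/cvgrPdist_lt => e e0.
have : \forall y \near x, forall ij : 'I_p * 'I_q, `|f x ij.1 ij.2 - f y ij.1 ij.2| < e.
  by apply: filter_forall => ij; have /cvgrPdist_lt/(_ e e0) := cf ij.1 ij.2.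
apply: filterS => y H.
have : ball (f x) e (f y).
  split => // i j.
  by have := H (i, j); rewrite -ball_normE.
by rewrite -ball_normE.
Qed.

Lemma C1_mx E p q (O : set E) (f : E -> 'M[K]_(p, q)) :
  open O -> (forall i j, C1_on O (fun x => f x i j : K)) ->
  C1_on O f.
Proof.
move=> oO hf.
have df x : O x -> differentiable f x.
  by move=> Ox; apply: differentiable_mx => i j; case: (hf i j x Ox).
apply: (C1_formula
  (D := fun x v => \matrix_(i, j) 'd (fun y => f y i j : K) x v)) => // x v Ox.
  by apply/matrixP => i j; rewrite mxE diff_entry //; exact: df.
apply: continuous_mx => i j.
rewrite (_ : (fun y => _) = fun y => 'd (fun y => f y i j : K) y v).
  exact: (hf i j x Ox).2.
by apply/funext => y; rewrite mxE.
Qed.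

Lemma C1_mulmx E p q r (O : set E) (f : E -> 'M[K]_(p, q))
    (h : E -> 'M[K]_(q, r)) : open O ->
  C1_on O f -> C1_on O h ->
  C1_on O (fun x => f x *m h x).
Proof.
move=> oO hf hh; apply: C1_mx => // i j.
under eq_fun do rewrite mxE.
apply: (@C1_sum _ _ _ _ _ _ (fun k x => f x i k * h x k j : K) oO) => k.
exact: (C1M oO (C1_entry _ _ oO hf) (C1_entry _ _ oO hh)).
Qed.

Lemma C1_det E n (O : set E) (h : E -> 'M[K]_n) : open O ->
  C1_on O h -> C1_on O (fun x => \det (h x) : K).
Proof.
move=> oO hh; rewrite /determinant; apply: C1_sum => // s.
apply: C1M => //; first exact: C1_cst.
by apply: C1_prod => // i; exact: C1_entry.
Qed.

Lemma open_unitmx n : open [set M : 'M[K]_n | M \in unitmx].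
Proof.
have cdet : continuous (fun M : 'M[K]_n => \det M : K).
  move=> M; apply: differentiable_continuous.
  have cid := @C1_linear_mx n n 'M[K]_n setT (idfun : {linear 'M[K]_n -> 'M[K]_n}).
  by have [] := @C1_det 'M[K]_n n setT id openT cid M I.
have -> : [set M : 'M[K]_n | M \in unitmx] = (fun M => \det M : K) @^-1` [set z | z != 0].
  by apply/funext => M; apply/propext; rewrite /= unitmxE unitfE.
move/continuousP: cdet; apply.
have -> : [set z : K | z != 0] = ~` [set 0].
  by apply/funext => z; apply/propext; split => /= [/eqP|z0]; [|exact/eqP].
by rewrite openC; exact/accessible_closed_set1/hausdorff_accessible/norm_hausdorff.
Qed.

(** By Cramer's rule the inverse is a quotient of polynomials in the entries. *)
Lemma C1_invmx E p (O : set E) (f : E -> 'M[K]_p) : open O ->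
  (forall x, O x -> f x \in unitmx) ->
  C1_on O f -> C1_on O (fun x => invmx (f x)).
Proof.
move=> oO uf hf.
have H : C1_on O (fun x => (\det (f x))^-1 *: \adj (f x)).
  apply: C1_mx => // i j; under eq_fun do rewrite !mxE.
  apply: C1M => //.
    apply: C1V => //; last exact: (C1_det oO).
    by move=> x /uf; rewrite unitmxE unitfE.
  apply: C1M => //; first exact: C1_cst.
  apply: (C1_det oO); apply: (C1_mx oO) => k l; under eq_fun do rewrite !mxE.
  exact: C1_entry.
apply: (C1_eq oO _ H) => x Ox.
by rewrite /invmx uf.
Qed.

Lemma continuous_invmx n (M : 'M[K]_n) : M \in unitmx -> {for M, continuous (@invmx K n : 'M[K]_n -> 'M[K]_n)}.
Proof.
move=> uM; apply: differentiable_continuous.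
have cid := @C1_linear_mx n n 'M[K]_n [set M | M \in unitmx]
  (idfun : {linear 'M[K]_n -> 'M[K]_n}).
by have [] := @C1_invmx 'M[K]_n n _ id (@open_unitmx n) (fun _ h => h) cid M uM.
Qed.

(** In finite dimension, continuity of each directional derivative gives joint
continuity of the differential in point and direction; the chain rule needs this. *)
Lemma continuous_diff p q F (O : set 'M[K]_(p, q)) (f : 'M[K]_(p, q) -> F)
    (T : topologicalType) (h k : T -> 'M[K]_(p, q)) t :
  C1_on O f -> O (h t) -> {for t, continuous h} -> {for t, continuous k} ->
  {for t, continuous (fun s => 'd f (h s) (k s))}.
Proof.
move=> hf Oht ch ck.
have -> : (fun s => 'd f (h s) (k s)) =
  fun s => \sum_i \sum_j k s i j *: 'd f (h s) (delta_mx i j).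
  by apply/funext => s; rewrite (linear_mx_delta ('d f (h s))).
have csum (I : finType) (g : I -> T -> F) :
    (forall i, {for t, continuous (g i)}) -> {for t, continuous (fun s => \sum_i g i s)}.
  move=> cg; rewrite (_ : (fun s => _) = \sum_i g i); last first.
    by apply/funext => s; rewrite fct_sumE.
  elim/big_ind: _ => [||i _]; last exact: cg.
    exact: cst_continuous.
  by move=> h1 h2 c1 c2; apply: continuousD.
apply: (csum _) => i; apply: (csum _) => j; apply: continuousZ.
  apply: (@continuous_comp _ _ _ k (fun M : 'M[K]_(p, q) => M i j)) => //.
  exact: coord_continuous.
apply: (@continuous_comp _ _ _ h (fun z => 'd f z (delta_mx i j))) => //.
exact: (hf _ Oht).2.
Qed.

Lemma C1_comp E p q F (O : set E) (O' : set 'M[K]_(p, q))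
    (f : 'M[K]_(p, q) -> F) (h : E -> 'M[K]_(p, q)) : open O ->
  (forall x, O x -> O' (h x)) -> C1_on O h -> C1_on O' f ->
  C1_on O (fun x => f (h x)).
Proof.
move=> oO OO' hh hf.
apply: (C1_formula (D := fun x v => 'd f (h x) ('d h x v))) => // x.
- by move=> Ox; apply: differentiable_comp; [case: (hh x Ox)|case: (hf _ (OO' x Ox))].
- move=> v Ox; apply: diff_comp_apply; first by case: (hh x Ox).
  by case: (hf _ (OO' x Ox)).
- move=> v Ox; apply: continuous_diff hf (OO' x Ox) _ _.
    by apply: differentiable_continuous; case: (hh x Ox).
  exact: (hh x Ox).2.
Qed.

End C1Maps.

Section C1Constructions.
Variable K : numFieldType.
Implicit Types E : normedModType K.

Lemma open_C1_preimage (E F : normedModType K) (O : set E) (O' : set F) (f : E -> F) :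
  open O -> C1_on O f -> open O' -> open [set x | O x /\ O' (f x)].
Proof.
move=> oO hf oO'; rewrite openE => x [Ox O'fx].
have cf : {for x, continuous f}.
  by apply: differentiable_continuous; have [] := hf x Ox.
near=> y; split; first by near: y; exact: open_nbhs_nbhs.
by near: y; apply: cf; exact: open_nbhs_nbhs.
Unshelve. all: by end_near. Qed.

Lemma eq_on_diff (E F : normedModType K) (O : set E) (f h : E -> F) x v :
  open O -> O x -> (forall y, O y -> f y = h y) -> differentiable f x ->
  'd h x v = 'd f x v.
Proof.
move=> oO Ox fh df; apply: (near_eq_diff _ df).2.
by near=> y; apply: fh; near: y; exact: open_nbhs_nbhs.
Unshelve. all: by end_near. Qed.

Lemma C1_line (F : normedModType K) (O : set K^o) (a b : F) : open O ->
  C1_on O (fun t : K^o => a + t *: b).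
Proof.
move=> oO; apply: (C1D oO); first exact: C1_cst.
have lin : linear (fun t : K^o => t *: b).
  by move=> c x y; rewrite scalerDl scalerA.
pose cM := GRing.isLinear.Build _ _ _ _ _ lin.
pose l : {linear K^o -> F} := HB.pack (fun t : K^o => t *: b) cM.
have cl : continuous l by exact: scalel_continuous.
exact: (@C1_linear K K^o F O l cl).
Qed.

Lemma diff_line (F : normedModType K) (a b : F) (s t : K^o) :
  'd (fun t : K^o => a + t *: b) s t = t *: b.
Proof.
have lin : linear (fun t : K^o => t *: b).
  by move=> c x y; rewrite scalerDl scalerA.
pose cM := GRing.isLinear.Build _ _ _ _ _ lin.
pose l : {linear K^o -> F} := HB.pack (fun t : K^o => t *: b) cM.
have cl : continuous l := @scalel_continuous K F b.
rewrite (diffD_apply t (differentiable_cst a s) (linear_differentiable s cl)).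
by rewrite diff_cst_apply add0r (diff_lin s cl).
Qed.

Lemma diff_curve (E : normedModType K) (c : K^o -> E) (t : K^o) (s : K) :
  differentiable c t -> 'd c t s = s *: derive1 c t.
Proof.
move=> dc; rewrite derive1E' //.
have sE : s = s *: (1 : K^o) by rewrite [RHS]mulr1.
by rewrite {1}sE linearZ.
Qed.

Lemma usubmx_mul p1 p2 q (M : 'M[K]_(p1 + p2, q)) : usubmx M = row_mx 1%:M 0 *m M.
Proof. by rewrite -{2}[M]vsubmxK mul_row_col mul1mx mul0mx addr0. Qed.

Lemma dsubmx_mul p1 p2 q (M : 'M[K]_(p1 + p2, q)) : dsubmx M = row_mx 0 1%:M *m M.
Proof. by rewrite -{2}[M]vsubmxK mul_row_col mul1mx mul0mx add0r. Qed.

Lemma rsubmx_mul p q1 q2 (M : 'M[K]_(p, q1 + q2)) : rsubmx M = M *m col_mx 0 1%:M.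
Proof. by rewrite -{2}[M]hsubmxK mul_row_col mulmx1 mulmx0 add0r. Qed.

Lemma col_mx_mul p1 p2 q (a : 'M[K]_(p1, q)) (b : 'M[K]_(p2, q)) :
  col_mx a b = col_mx 1%:M 0 *m a + col_mx 0 1%:M *m b.
Proof. by rewrite !mul_col_mx !mul1mx !mul0mx add_col_mx addr0 add0r. Qed.

Lemma row_mx_mul p q1 q2 (a : 'M[K]_(p, q1)) (b : 'M[K]_(p, q2)) :
  row_mx a b = a *m row_mx 1%:M 0 + b *m row_mx 0 1%:M.
Proof. by rewrite !mul_mx_row !mulmx1 !mulmx0 add_row_mx addr0 add0r. Qed.

Lemma C1_mulmxl E p q r (O : set E) (S : 'M[K]_(p, q)) (f : E -> 'M[K]_(q, r)) :
  open O -> C1_on O f -> C1_on O (fun x => S *m f x).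
Proof. by move=> oO hf; exact: (C1_mulmx oO (@C1_cst K E _ O S) hf). Qed.

Lemma C1_mulmxr E p q r (O : set E) (f : E -> 'M[K]_(p, q)) (S : 'M[K]_(q, r)) :
  open O -> C1_on O f -> C1_on O (fun x => f x *m S).
Proof. by move=> oO hf; exact: (C1_mulmx oO hf (@C1_cst K E _ O S)). Qed.

Lemma C1_col_mx E p1 p2 q (O : set E) (f : E -> 'M[K]_(p1, q)) (h : E -> 'M[K]_(p2, q)) :
  open O -> C1_on O f -> C1_on O h -> C1_on O (fun x => col_mx (f x) (h x)).
Proof.
move=> oO hf hh.
apply: (C1_eq oO _ (C1D oO (C1_mulmxl (col_mx 1%:M 0) oO hf) (C1_mulmxl (col_mx 0 1%:M) oO hh))).
by move=> x _; rewrite col_mx_mul.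
Qed.

Lemma C1_row_mx E p q1 q2 (O : set E) (f : E -> 'M[K]_(p, q1)) (h : E -> 'M[K]_(p, q2)) :
  open O -> C1_on O f -> C1_on O h -> C1_on O (fun x => row_mx (f x) (h x)).
Proof.
move=> oO hf hh.
apply: (C1_eq oO _ (C1D oO (C1_mulmxr (row_mx 1%:M 0) oO hf) (C1_mulmxr (row_mx 0 1%:M) oO hh))).
by move=> x _; rewrite row_mx_mul.
Qed.

Lemma C1_usubmx E p1 p2 q (O : set E) (f : E -> 'M[K]_(p1 + p2, q)) :
  open O -> C1_on O f -> C1_on O (fun x => usubmx (f x)).
Proof.
move=> oO hf; apply: (C1_eq oO _ (C1_mulmxl (row_mx 1%:M 0) oO hf)).
by move=> x _; rewrite usubmx_mul.
Qed.

Lemma C1_dsubmx E p1 p2 q (O : set E) (f : E -> 'M[K]_(p1 + p2, q)) :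
  open O -> C1_on O f -> C1_on O (fun x => dsubmx (f x)).
Proof.
move=> oO hf; apply: (C1_eq oO _ (C1_mulmxl (row_mx 0 1%:M) oO hf)).
by move=> x _; rewrite dsubmx_mul.
Qed.

Lemma C1_rsubmx E p q1 q2 (O : set E) (f : E -> 'M[K]_(p, q1 + q2)) :
  open O -> C1_on O f -> C1_on O (fun x => rsubmx (f x)).
Proof.
move=> oO hf; apply: (C1_eq oO _ (C1_mulmxr (col_mx 0 1%:M) oO hf)).
by move=> x _; rewrite rsubmx_mul.
Qed.

Lemma lsubmx_mul p q1 q2 (M : 'M[K]_(p, q1 + q2)) : lsubmx M = M *m col_mx 1%:M 0.
Proof. by rewrite -{2}[M]hsubmxK mul_row_col mulmx1 mulmx0 addr0. Qed.

Lemma C1_lsubmx E p q1 q2 (O : set E) (f : E -> 'M[K]_(p, q1 + q2)) :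
  open O -> C1_on O f -> C1_on O (fun x => lsubmx (f x)).
Proof.
move=> oO hf; apply: (C1_eq oO _ (C1_mulmxr (col_mx 1%:M 0) oO hf)).
by move=> x _; rewrite lsubmx_mul.
Qed.

Lemma diff_lsubmx E p q1 q2 (f : E -> 'M[K]_(p, q1 + q2)) x v :
  differentiable f x -> 'd (fun y => lsubmx (f y)) x v = lsubmx ('d f x v).
Proof.
move=> df; rewrite lsubmx_mul -(diff_mulmxr (col_mx 1%:M 0) df).2.
by congr ('d _ x v); apply/funext => y; rewrite lsubmx_mul.
Qed.

Lemma diff_rsubmx E p q1 q2 (f : E -> 'M[K]_(p, q1 + q2)) x v :
  differentiable f x -> 'd (fun y => rsubmx (f y)) x v = rsubmx ('d f x v).
Proof.
move=> df; rewrite rsubmx_mul -(diff_mulmxr (col_mx 0 1%:M) df).2.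
by congr ('d _ x v); apply/funext => y; rewrite rsubmx_mul.
Qed.

Lemma C1_id E (O : set E) : C1_on O (fun x : E => x).
Proof.
exact: (@C1_linear K E E O (idfun : {linear E -> E}) (fun x => @cvg_id E (nbhs x))).
Qed.

Lemma diff_usubmx E p1 p2 q (f : E -> 'M[K]_(p1 + p2, q)) x v :
  differentiable f x -> 'd (fun y => usubmx (f y)) x v = usubmx ('d f x v).
Proof.
move=> df; rewrite usubmx_mul -(diff_mulmxl (row_mx 1%:M 0) df).2.
by congr ('d _ x v); apply/funext => y; rewrite usubmx_mul.
Qed.

Lemma diff_col_mx E p1 p2 q (f : E -> 'M[K]_(p1, q)) (h : E -> 'M[K]_(p2, q)) x v :
  differentiable f x -> differentiable h x ->
  'd (fun y => col_mx (f y) (h y)) x v = col_mx ('d f x v) ('d h x v).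
Proof.
move=> df dh; have [d1 e1] := diff_mulmxl (col_mx 1%:M 0 : 'M[K]_(p1 + p2, p1)) df.
have [d2 e2] := diff_mulmxl (col_mx 0 1%:M : 'M[K]_(p1 + p2, p2)) dh.
rewrite col_mx_mul -e1 -e2 -(diffD_apply v d1 d2).
by congr ('d _ x v); apply/funext => y; rewrite col_mx_mul.
Qed.

(** A projector onto [F] fixes the curve, hence its velocity. *)
Lemma velocity_in_subspace p q (F : {vspace 'M[K]_(p, q)}) (O : set K^o)
    (c : K^o -> 'M[K]_(p, q)) (t : K^o) :
  open O -> O t -> differentiable c t -> (forall s, O s -> c s \in F) ->
  'd c t 1 \in F.
Proof.
move=> oO Ot dc cF; pose pr : {linear 'M[K]_(p, q) -> 'M[K]_(p, q)} := projv F.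
have dpr : differentiable pr (c t) by case: (is_diff_linear_mx pr (c t)).
have := eq_on_diff (1 : K^o) oO Ot (fun s Os => esym (projv_id (cF s Os))) dc.
rewrite [LHS](diff_comp_apply (1 : K^o) dc dpr) diff_linear_mx_apply => <-.
exact: memv_proj.
Qed.

End C1Constructions.

(** * Real-valued norms of complex vectors *)

Section RealNorm.
Variable R : realType.
Local Notation C := (Cplx R).
Implicit Types E F : normedModType C.

(** The norm of a normed module over [Cplx R] takes values in [Cplx R]; its real part
allows estimates in the ordered field [R]. *)
Definition nm E (v : E) : R := complex.Re (`|v| : R[i]).

Lemma nmE E (v : E) : `|v| = (nm v)%:C :> R[i].
Proof. by rewrite /nm RRe_real //; exact: (normr_real v). Qed.

Lemma nm_ge0 E (v : E) : 0 <= nm v.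
Proof. by rewrite -lecR -nmE; exact: (normr_ge0 v). Qed.

Lemma nm0 E : nm (0 : E) = 0.
Proof. by apply: (@complexI R); rewrite -nmE; exact: (normr0 E). Qed.

Lemma nm_eq0 E (v : E) : nm v = 0 -> v = 0.
Proof. by move=> h; apply: (@normr0_eq0 _ E); have := nmE v; rewrite h. Qed.

Lemma nmD E (v w : E) : nm (v + w) <= nm v + nm w.
Proof. rewrite -lecR rmorphD /= -!nmE. exact: (ler_normD v w). Qed.

Lemma nmN E (v : E) : nm (- v) = nm v.
Proof. by apply: (@complexI R); rewrite -!nmE; exact: (normrN v). Qed.

Lemma nmB E (v w : E) : nm (v - w) <= nm v + nm w.
Proof. by rewrite -(nmN w); exact: nmD. Qed.

Lemma nm_distC E (v w : E) : nm (v - w) = nm (w - v).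
Proof. by rewrite -nmN opprB. Qed.

Lemma nmZ E (a : C) (v : E) : nm (a *: v) = nm (a : C) * nm v.
Proof.
apply: (@complexI R); rewrite rmorphM /= -!nmE; exact: (normrZ a v).
Qed.

Lemma nm_real (t : R) : nm (t%:C : C) = `|t|.
Proof.
apply: (@complexI R); rewrite -nmE.
by rewrite (normc_def t%:C) /= expr0n addr0 sqrtr_sqr.
Qed.

Lemma nm_Re (z : C) : `|complex.Re z| <= nm z.
Proof.
rewrite /nm (normc_def z) /= -sqrtr_sqr; apply: ler_wsqrtr.
by rewrite lerDl sqr_ge0.
Qed.

Lemma nm_le_ReIm (z : C) : nm z <= `|complex.Re z| + `|complex.Im z|.
Proof.
case: z => a b; rewrite /nm (normc_def (a +i* b)) /=.
rewrite -[leRHS]ger0_norm ?addr_ge0 // -sqrtr_sqr; apply: ler_wsqrtr.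
rewrite sqrrD !real_normK ?num_real //.
have := mulr_ge0 (normr_ge0 a) (normr_ge0 b); lra.
Qed.

Lemma nm_Im (z : C) : `|complex.Im z| <= nm z.
Proof.
rewrite /nm (normc_def z) /= -sqrtr_sqr; apply: ler_wsqrtr.
by rewrite lerDr sqr_ge0.
Qed.

Lemma ball_nm E (x y : E) (e : R) :
  ball x (e%:C : C) y <-> nm (y - x) < e.
Proof.
rewrite -ball_normE /= nm_distC -ltcR -nmE; split => h; exact: h.
Qed.

Lemma nbhs_nmP E (x : E) (P : set E) :
  nbhs x P <-> exists2 e : R, 0 < e & forall y, nm (y - x) < e -> P y.
Proof.
split => [/nbhs_ballP[e e0 eP]|[e e0 eP]].
  have eE : ((complex.Re (e : R[i]))%:C : C) = e.
    by apply: RRe_real; exact: gtr0_real.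
  exists (complex.Re (e : R[i])).
    by rewrite -ltcR; move: e0; rewrite /= -{1}eE.
  by move=> y /ball_nm; rewrite eE => /eP.
apply/nbhs_ballP; exists (e%:C : C); first by rewrite /= ltcR.
by move=> y /ball_nm/eP.
Qed.

Lemma nm_entry p q (M : 'M[C]_(p, q)) i j : nm (M i j : C) <= nm M.
Proof.
rewrite leNgt; apply/negP => h.
have /ball_nm : nm (M - 0) < nm (M i j : C) by rewrite subr0.
move=> [_ /(_ i j)]; rewrite mxE => /(ball_nm (0 : C)).
by rewrite subr0 ltxx.
Qed.

Lemma nm_mx_le p q (M : 'M[C]_(p, q)) (k : R) :
  0 <= k -> (forall i j, nm (M i j : C) <= k) -> nm M <= k.
Proof.
move=> k0 h; apply/ler_addgt0Pr => e e0; apply: ltW.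
rewrite -[M]subr0; apply/ball_nm; split.
  by rewrite ltcR ltr_wpDl.
move=> i j; rewrite mxE; apply/(ball_nm (0 : C)); rewrite subr0.
by rewrite (le_lt_trans (h i j)) // ltrDl.
Qed.

Lemma nm_mulmx p q r (a : 'M[C]_(p, q)) (b : 'M[C]_(q, r)) :
  nm (a *m b) <= q%:R * (nm a * nm b).
Proof.
have ab0 : 0 <= nm a * nm b by rewrite mulr_ge0 ?nm_ge0.
apply: nm_mx_le => [|i j]; first by rewrite mulr_ge0 ?ler0n.
rewrite mxE; have -> : q%:R * (nm a * nm b) = \sum_(k < q) nm a * nm b.
  by rewrite sumr_const card_ord mulr_natl.
elim/big_ind2: _ => [|z s w t zs wt|k _]; first by rewrite nm0.
  by apply: le_trans (nmD _ _) _; exact: lerD.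
by rewrite [X in X <= _](nmZ (a i k) (b k j : C)) ler_pM ?nm_ge0 ?nm_entry.
Qed.

Lemma open_nm_ball (E : normedModType C) (x0 : E) (r : R) : open [set y | nm (y - x0) < r].
Proof.
rewrite openE => y yr; apply/nbhs_nmP; exists (r - nm (y - x0)).
  by rewrite subr_gt0.
move=> z zy /=; have -> : z - x0 = (z - y) + (y - x0) by rewrite addrA subrK.
by apply: le_lt_trans (nmD _ _) _; rewrite -ltrBrDr.
Qed.

Lemma linear_bound p q F (f : {linear 'M[C]_(p, q) -> F}) :
  exists2 k : R, 0 < k & forall v, nm (f v) <= k * nm v.
Proof.
have [k k0 hk] := linear_lipschitz (@continuous_linear_mx C p q F f).
have kE : ((complex.Re (k : R[i]))%:C : C) = k.
  by apply: RRe_real; exact: gtr0_real.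
exists (complex.Re (k : R[i])).
  by rewrite -ltcR; move: k0; rewrite /= -{1}kE.
by move=> v; rewrite -lecR rmorphM /= -!nmE [X in X * _]kE; exact: hk.
Qed.

Lemma nm_diff E F (f : E -> F) x (e : R) : differentiable f x -> 0 < e ->
  exists2 d : R, 0 < d & forall y, nm (y - x) < d ->
    nm (f y - f x - 'd f x (y - x)) <= e * nm (y - x).
Proof.
move=> df e0.
have fE := diff_locallyx df.
have : \forall h \near (0 : E), nm (f (h + x) - f x - 'd f x h) <= e * nm h.
  near=> h; rewrite fE.
  rewrite -addrA -opprD addrC addKr.
  rewrite -lecR rmorphM /= -!nmE.
  near: h; apply: littleoP; first by rewrite ltcR.
move=> /nbhs_nmP[d d0 hd]; exists d => // y yd.
by have := hd (y - x); rewrite subr0 subrK; exact.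
Unshelve. all: by end_near. Qed.

(** Converse of [nm_diff]: a linear map with a small remainder is the differential. *)
Lemma diff_of_remainder E F (f : E -> F) x (L : {linear E -> F}) :
  continuous L ->
  (forall e : R, 0 < e -> exists2 d : R, 0 < d & forall y, nm (y - x) < d ->
    nm (f y - f x - L (y - x)) <= e * nm (y - x)) ->
  differentiable f x /\ 'd f x = L :> (E -> F).
Proof.
move=> cL hL.
have H : f \o shift x = cst (f x) + L +o_ 0 id.
  apply/eqaddoE.
  pose r := fun h : E => f (h + x) - f x - L h.
  have o0 : r =o_ 0 id.
    apply/eqoP => e e0.
    have eE : ((complex.Re (e : R[i]))%:C : C) = e.
      by apply: RRe_real; exact: gtr0_real.
    have {}e0 : 0 < complex.Re (e : R[i]).
      by rewrite -ltcR; move: e0; rewrite /= -{1}eE.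
    have [d d0 hd] := hL _ e0.
    apply/nbhs_nmP; exists d => // h; rewrite subr0 => hh.
    have := hd (h + x); rewrite addrK => /(_ hh).
    by rewrite -lecR rmorphM /= -!nmE eE.
  have fE y : f (y + x) = f x + L y + r y by rewrite /r -[_ - _ - _]addrA -opprD [RHS]addrC subrK.
  by apply/funext => y; rewrite !fctE /= fE {1}o0.
have eL := diff_unique cL H.
by split; [apply/diff_locallyP; rewrite eL | exact: eL].
Qed.

(** Finite dimension turns continuity of the partial derivatives into continuity of
the differential uniformly in the direction. *)
Lemma C1_diff_close p q F (O : set 'M[C]_(p, q)) (f : 'M[C]_(p, q) -> F) x (e : R) :
  open O -> O x -> C1_on O f -> 0 < e ->
  exists2 d : R, 0 < d & forall y, nm (y - x) < d ->
    O y /\ forall v, nm ('d f y v - 'd f x v) <= e * nm v.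
Proof.
move=> oO Ox hf e0.
pose n := (p * q)%N.
pose e' := e / n.+1%:R.
have e'0 : 0 < e' by rewrite divr_gt0 // ltr0n.
have : \forall y \near x, O y /\ forall ij : 'I_p * 'I_q,
    nm ('d f y (delta_mx ij.1 ij.2) - 'd f x (delta_mx ij.1 ij.2)) <= e'.
  near=> y; split; first by near: y; exact: open_nbhs_nbhs.
  near: y; apply: filter_forall => ij.
  have /cvgrPdist_le/(_ (e'%:C : C)) := (hf x Ox).2 (delta_mx ij.1 ij.2).
  rewrite ltcR => /(_ e'0); apply: filterS => y.
  by rewrite nm_distC -lecR -nmE.
move=> /nbhs_nmP[d d0 hd]; exists d => // y /hd[Oy hy]; split => // v.
rewrite (linear_mx_deltaB ('d f y) ('d f x)).
have nms (I : finType) (g : I -> F) k : (forall i, nm (g i) <= k) ->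
    nm (\sum_i g i) <= #|I|%:R * k.
  move=> gk; rewrite mulrC mulr_natr -sumr_const.
  elim/big_ind2: _ => //; first by rewrite nm0.
  by move=> a b c d' ab cd; rewrite (le_trans (nmD _ _)) // lerD.
apply: (@le_trans _ _ (p%:R * (q%:R * (nm v * e')))).
  rewrite -[p in p%:R]card_ord; apply: (nms _) => i.
  rewrite -[q in q%:R]card_ord; apply: (nms _) => j.
  by rewrite nmZ ler_pM ?nm_ge0 // ?nm_entry //; exact: (hy (i, j)).
rewrite mulrA -natrM -/n /e' mulrCA [leRHS]mulrC ler_wpM2l ?nm_ge0 //.
rewrite mulrCA ger_pMr // ler_pdivrMr ?ltr0n // mul1r ler_nat //.
Unshelve. all: by end_near. Qed.

End RealNorm.

(** * The mean value inequality *)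

Section MeanValue.
Variable R : realType.
Local Notation C := (Cplx R).
Implicit Types E F : normedModType C.

Lemma Re_mul_increment (u a b D : R[i]) (h : R) :
  complex.Re (u * a) - complex.Re (u * b) - h * complex.Re (u * D) =
  complex.Re (u * (a - b - h%:C * D)).
Proof. by case: u a b D => [? ?] [? ?] [? ?] [? ?] /=; ring. Qed.

(** Composing with the real part of a rotation turns a complex derivative into a
derivative of a real function of a real variable. *)
Lemma is_derive_Re_line E (f : E -> C) (x v : E) (u : C) (t : R) :
  nm u = 1 -> differentiable f (x + t%:C *: v) ->
  is_derive t 1 (fun s : R => complex.Re (u * f (x + s%:C *: v) : R[i]))
    (complex.Re (u * 'd f (x + t%:C *: v) v : R[i])).
Proof.
move=> u1 df; set l := complex.Re _; set rho := fun s : R => _.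
have H : h^-1 *: ((rho \o shift t) (h *: (1 : R)) - rho t) @[h --> 0^'] --> l.
  apply/cvgrPdist_le => e e0.
  pose c := nm v + 1.
  have c0 : 0 < c by rewrite /c ltr_wpDl ?nm_ge0.
  have ec : 0 < e / c by rewrite divr_gt0.
  have [d d0 hd] := nm_diff df ec.
  have dc : 0 < d / c by rewrite divr_gt0.
  near=> h.
  have h0 : h != 0 by near: h; exact: nbhs_dnbhs_neq.
  have hdc : `|h| < d / c.
    by near: h; exact: dnbhs0_lt.
  rewrite -[l in X in X <= _](mulKf h0) -[_ *: _]/(_ * _) -mulrBr normrM normfV.
  rewrite ler_pdivrMl ?normr_gt0 // distrC.
  pose y := x + (h + t)%:C *: v.
  have yE : y - (x + t%:C *: v) = (h%:C : C) *: v.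
    by rewrite /y rmorphD scalerDl (addrC _ (_ *: v)) addrA (addrC _ (_ *: v)) addrK.
  have -> : (rho \o shift t) (h *: 1) - rho t - h * l =
      complex.Re (u * (f y - f (x + t%:C *: v) - 'd f (x + t%:C *: v) (y - (x + t%:C *: v))) : R[i]).
    rewrite yE [X in u * (_ - X)]linearZ -[RHS]Re_mul_increment.
    by rewrite /rho /= [h *: 1]mulr1 -/y.
  apply: le_trans (nm_Re _) _.
  rewrite [X in X <= _](nmZ u (_ : C)) u1 mul1r.
  have hv : `|h| * nm v <= `|h| * c by rewrite ler_wpM2l // lerDl.
  apply: le_trans (hd _ _) _.
    rewrite yE nmZ nm_real (le_lt_trans hv) //.
    by move: hdc; rewrite ltr_pdivlMr.
  rewrite yE nmZ nm_real; apply: le_trans (_ : _ <= e / c * (`|h| * c)) _.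
    by rewrite ler_wpM2l // ltW.
  by rewrite mulrCA divfK // gt_eqF.
by apply: DeriveDef; [exact: cvgP H|exact: cvg_lim H].
Unshelve. all: by end_near. Qed.

(** Rotate so that the increment of [f] becomes real, then apply the real mean value
theorem. *)
Lemma mean_value E (f : E -> C) (x v : E) (k : R) :
  (forall t : R, 0 <= t <= 1 -> differentiable f (x + t%:C *: v) /\
     nm ('d f (x + t%:C *: v) v : C) <= k) ->
  nm (f (x + v) - f x : C) <= k.
Proof.
move=> h.
have k0 : 0 <= k.
  by have [_ /(le_trans _)] := h 0 (introT andP (conj (lexx _) ler01)); apply; exact: nm_ge0.
set w := f (x + v) - f x.
have [w0|w0] := eqVneq w 0; first by rewrite w0 nm0.
pose u : C := `|w| / w.
have uw : u * w = (nm w)%:C by rewrite /u divfK // -nmE.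
have nw0 : nm w != 0 by apply: contra_neq w0 => /nm_eq0.
have u1 : nm u = 1.
  apply: (mulIf nw0); rewrite mul1r -[LHS](nmZ u w) [_ *: _]uw nm_real.
  by rewrite ger0_norm ?nm_ge0.
pose rho := fun s : R => complex.Re (u * f (x + s%:C *: v) : R[i]).
have dr (t : R) : 0 <= t <= 1 -> is_derive t 1 rho (complex.Re (u * 'd f (x + t%:C *: v) v : R[i])).
  by move=> /h[df _]; exact: is_derive_Re_line.
have cr : {within `[0, 1], continuous rho}.
  apply: derivable_within_continuous => t; rewrite in_itv /= => /dr[].
  by [].
have dr' (t : R) : t \in `]0, 1[ -> is_derive t 1 rho
    (complex.Re (u * 'd f (x + t%:C *: v) v : R[i])).
  by move=> /subset_itv_oo_cc; rewrite in_itv /=; exact: dr.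
have [t /subset_itv_oo_cc t01 E1] := MVT (ltr01 : 0 < 1 :> R) dr' cr.
have <- : rho 1 - rho 0 = nm w.
  rewrite /rho scale1r scale0r addr0.
  have -> (a b : R[i]) : complex.Re (u * a) - complex.Re (u * b) = complex.Re (u * (a - b)).
    by rewrite mulrBr; case: (u * a) (u * b) => ? ? [].
  by rewrite [u * _]uw.
rewrite E1 subr0 mulr1.
have [_ le_k] := h t t01.
apply: le_trans (ler_norm _) _; apply: le_trans (nm_Re _) _.
by rewrite [X in X <= _](nmZ u (_ : C)) u1 mul1r.
Qed.

Lemma mean_value_mx E p q (f : E -> 'M[C]_(p, q)) (x v : E) (k : R) :
  (forall t : R, 0 <= t <= 1 -> differentiable f (x + t%:C *: v) /\
     nm ('d f (x + t%:C *: v) v) <= k) ->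
  nm (f (x + v) - f x) <= k.
Proof.
move=> h; apply: nm_mx_le => [|i j].
  by have [_ /(le_trans _)] := h 0 (introT andP (conj (lexx _) ler01)); apply; exact: nm_ge0.
rewrite !mxE; apply: (mean_value (f := fun y => f y i j)) => t /h[df le_k].
split; first exact: differentiable_entry.
rewrite (diff_entry i j v df); exact: le_trans (nm_entry _ _ _) le_k.
Qed.

Lemma ball_segment E (a x y : E) (r : R) (t : R) : 0 <= t <= 1 ->
  nm (x - a) < r -> nm (y - a) < r -> nm (x + t%:C *: (y - x) - a) < r.
Proof.
move=> /andP[t0 t1] xr yr.
have -> : x + t%:C *: (y - x) - a = ((1 - t)%:C : C) *: (x - a) + (t%:C : C) *: (y - a).
  rewrite rmorphB rmorph1 [in RHS]scalerBl scale1r -[RHS]addrA.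
  by rewrite [X in _ = _ + X]addrC -scalerBr opprB addrA subrK addrAC.
apply: le_lt_trans (nmD _ _) _; rewrite !nmZ !nm_real !ger0_norm ?subr_ge0 //.
move: (nm (x - a)) (nm (y - a)) xr yr => X Y xr yr.
by case: (leP X Y) => XY; [apply: le_lt_trans _ yr | apply: le_lt_trans _ xr]; nra.
Qed.
End MeanValue.

(** * The inverse function theorem *)

Section InverseFunction.
Variable R : realType.
Local Notation C := (Cplx R).

(** Correcting the sequence by twice its step bound makes it monotone, from below
and from above, so that its limit is a supremum. *)
Lemma geometric_limit_real (a : nat -> R) (c : R) :
  (forall k, `|a k.+1 - a k| <= c / 2 ^+ k) ->
  exists l, forall k, `|a k - l| <= 2 * (c / 2 ^+ k).
Proof.
move=> ha; pose q k := c / 2 ^+ k.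
have qS k : q k.+1 = q k / 2 by rewrite /q exprS invfM mulrA mulrAC.
have q0 k : 0 <= q k by exact: le_trans (ha k).
pose lo k := a k - 2 * q k; pose hi k := a k + 2 * q k.
have loS k : lo k <= lo k.+1.
  by have := ha k; rewrite -/(q k) ler_norml /lo qS => /andP[]; lra.
have hiS k : hi k.+1 <= hi k.
  by have := ha k; rewrite -/(q k) ler_norml /hi qS => /andP[]; lra.
have lo_homo : {homo lo : i j / (i <= j)%N >-> i <= j}.
  by apply: homo_leq => //; exact: le_trans.
have hi_homo : {homo hi : i j / (i <= j)%N >-> j <= i}.
  apply: (@homo_leq _ _ (fun x y => y <= x)) => // y x z yx zy; exact: le_trans zy yx.
have lohi i j : lo i <= hi j.
  have lh : lo (maxn i j) <= hi (maxn i j) by have := q0 (maxn i j); rewrite /lo /hi; lra.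
  by apply: le_trans (lo_homo _ _ (leq_maxl i j)) (le_trans lh (hi_homo _ _ (leq_maxr i j))).
exists (sup (range lo)) => k.
have lo_sup : lo k <= sup (range lo).
  apply: ub_le_sup; last by exists k.
  by exists (hi 0%N) => _ [i _ <-].
have sup_hi : sup (range lo) <= hi k.
  by apply: ge_sup; [exists (lo 0%N), 0%N | move=> _ [i _ <-]].
by rewrite ler_norml -/(q k); move: lo_sup sup_hi; rewrite /lo /hi => *; apply/andP; split; lra.
Qed.

Lemma geometric_limit p q (u : nat -> 'M[C]_(p, q)) (c : R) :
  (forall k, nm (u k.+1 - u k) <= c / 2 ^+ k) ->
  exists l, forall k, nm (u k - l) <= 4 * (c / 2 ^+ k).
Proof.
move=> hu.
have ReB (z w : R[i]) : complex.Re (z - w) = complex.Re z - complex.Re w.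
  by case: z w => ? ? [].
have ImB (z w : R[i]) : complex.Im (z - w) = complex.Im z - complex.Im w.
  by case: z w => ? ? [].
have hij i j : exists z : C, forall k, nm (u k i j - z : C) <= 4 * (c / 2 ^+ k).
  have hk k : nm (u k.+1 i j - u k i j : C) <= c / 2 ^+ k.
    by apply: le_trans (hu k); have := nm_entry (u k.+1 - u k) i j; rewrite !mxE.
  have [x hx] : exists l, forall k, `|complex.Re (u k i j : R[i]) - l| <= 2 * (c / 2 ^+ k).
    apply: geometric_limit_real => k; apply: le_trans (hk k).
    by rewrite -ReB; exact: nm_Re.
  have [y hy] : exists l, forall k, `|complex.Im (u k i j : R[i]) - l| <= 2 * (c / 2 ^+ k).
    apply: geometric_limit_real => k; apply: le_trans (hk k).
    by rewrite -ImB; exact: nm_Im.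
  exists (x +i* y : R[i]) => k; apply: le_trans (nm_le_ReIm _) _.
  rewrite ReB ImB /=; have := hx k; have := hy k; lra.
pose l := \matrix_(i, j) sval (cid (hij i j)).
exists l => k; apply: nm_mx_le => [|i j].
  by rewrite mulr_ge0 // (le_trans _ (hu k)) ?nm_ge0.
by rewrite !mxE; case: cid.
Qed.

Lemma small_geometric (a c : R) : (forall k, a <= c / 2 ^+ k) -> a <= 0.
Proof.
move=> h; rewrite leNgt; apply/negP => a0.
have [k hk] : exists k, c / a < 2 ^+ k.
  exists (Num.truncn (`|c / a|)).+1.
  apply: le_lt_trans (ler_norm _) _; apply: lt_le_trans (truncnS_gt _) _.
  by rewrite -natrX ler_nat ltnW // ltn_expl.
have := h k; rewrite leNgt => /negP; apply.
by rewrite ltr_pdivrMr ?exprn_gt0 // mulrC -ltr_pdivrMr.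
Qed.


(** Picard iteration for the fixed points of y |-> b - psi y: the steps halve, so the
iterates never leave the ball. *)
Lemma perturbed_identity_onto p q (psi : 'M[C]_(p, q) -> 'M[C]_(p, q)) a b (r : R) :
  (forall y y', nm (y - a) < r -> nm (y' - a) < r ->
     nm (psi y - psi y') <= nm (y - y') / 2) ->
  2 * nm (b - psi a - a) < r ->
  exists2 y, nm (y - a) < r & y + psi y = b.
Proof.
move=> hpsi hb; pose c := nm (b - psi a - a); have c0 : 0 <= c := nm_ge0 _.
pose u := fun k => iter k (fun y => b - psi y) a; pose step k := c / 2 ^+ k.
have uS k : u k.+1 = b - psi (u k) by [].
have q0 k : 0 <= step k by rewrite divr_ge0 // exprn_ge0.
have qS k : step k.+1 = step k / 2 by rewrite /step exprS invfM mulrA mulrAC.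
have in_ball k : nm (u k - a) <= 2 * (c - step k) -> nm (u k - a) < r.
  by move=> h; apply: le_lt_trans h (le_lt_trans _ hb); rewrite ler_pM2l // gerBl.
have H k : nm (u k - a) <= 2 * (c - step k) /\ nm (u k.+1 - u k) <= step k.
  elim: k => [|k [IH1 IH2]].
    rewrite /step expr0 divr1 [u 0%N - a]subrr nm0; split; last exact: lexx.
    by rewrite subrr mulr0.
  have H1 : nm (u k.+1 - a) <= 2 * (c - step k.+1).
    have -> : u k.+1 - a = (u k.+1 - u k) + (u k - a) by rewrite addrA subrK.
    have -> : 2 * (c - step k.+1) = step k + 2 * (c - step k) by rewrite qS; field.
    by apply: le_trans (nmD _ _) _; exact: lerD.
  split => //.
  have -> : u k.+2 - u k.+1 = psi (u k) - psi (u k.+1).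
    by rewrite (uS k.+1) {2}(uS k) opprB addrC addrA subrK.
  rewrite qS; apply: le_trans (hpsi _ _ (in_ball k IH1) (in_ball _ H1)) _.
  by rewrite ler_pM2r // nm_distC.
have [y hy] := geometric_limit (fun k => (H k).2).
have ya : nm (y - a) <= 2 * c.
  rewrite -subr_le0; apply: (@small_geometric _ (4 * c)) => k.
  have -> : y - a = (u k - a) - (u k - y) by rewrite opprB [RHS]addrC addrA subrK.
  rewrite lerBlDr; apply: le_trans (nmB _ _) _.
  apply: le_trans (lerD (H k).1 (hy k)) _; rewrite -mulrA -/(step k).
  by move: (q0 k); clear; lra.
have yr : nm (y - a) < r by apply: le_lt_trans ya hb.
exists y => //; apply/eqP; rewrite -subr_eq0; apply/eqP/nm_eq0/eqP.
rewrite eq_le nm_ge0 andbT; apply: (@small_geometric _ (4 * c)) => k.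
have -> : y + psi y - b = (psi y - psi (u k)) + (y - u k.+1).
  rewrite uS opprB [y + (_ - b)]addrC [RHS]addrA [psi y - _ + _]addrA subrK.
  by rewrite [y + psi y]addrC addrAC.
apply: le_trans (nmD _ _) _.
have h1 : nm (psi y - psi (u k)) <= 4 * step k / 2.
  apply: le_trans (hpsi _ _ yr (in_ball k (H k).1)) _.
  by rewrite ler_pM2r // nm_distC; exact: hy.
have h2 : nm (y - u k.+1) <= 4 * (step k / 2).
  by rewrite nm_distC -qS; exact: hy.
apply: le_trans (lerD h1 h2) _; rewrite -[leRHS]mulrA [4 * (step k / 2)]mulrA -splitr.
exact: lexx.
Qed.

(** With S the inverse of the differential at [a], the map y |-> S (f y) - y is a
1/2-contraction near [a], so each w near f a has a preimage there.  The contraction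
estimate makes the preimage a Lipschitz function of w, and its differential is
then forced to be the inverse of the differential of [f]. *)
Theorem local_right_inverse n (O : set 'rV[C]_n) (f : 'rV[C]_n -> 'rV[C]_n) a :
  open O -> O a -> C1_on O f -> (forall v, 'd f a v = 0 -> v = 0) ->
  exists (O2 : set 'rV[C]_n) (h : 'rV[C]_n -> 'rV[C]_n),
    [/\ open O2, O2 (f a), C1_on O2 h & forall w, O2 w -> O (h w) /\ f (h w) = w].
Proof.
move=> oO Oa hf inj.
have J_unit y : (forall v, 'd f y v = 0 -> v = 0) -> lin1_mx ('d f y) \in unitmx.
  move=> injy; rewrite -row_free_unit -kermx_eq0.
  apply/eqP/row_matrixP => i; rewrite row0; apply: injy.
  by rewrite -(mul_rV_lin1 ('d f y)) -row_mul mulmx_ker row0.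
have dfE y v : 'd f y v = v *m lin1_mx ('d f y) by rewrite mul_rV_lin1.
pose S := invmx (lin1_mx ('d f a)).
have dfS v : 'd f a v *m S = v by rewrite dfE mulmxK // J_unit.
have [kS kS0 hS] := linear_bound (mulmxr S : {linear 'rV[C]_n -> 'rV[C]_n}).
(* Variation of the differential small enough that S halves it. *)
have e0 : 0 < (2 * kS)^-1 by rewrite invr_gt0 mulr_gt0.
have [r r0 hr] := C1_diff_close oO Oa hf e0.
pose psi y := f y *m S - y.
have close y v : nm (y - a) < r -> nm ('d f y v *m S - v) <= nm v / 2.
  move=> /hr[_ /(_ v) h].
  rewrite -{2}(dfS v) -mulmxBl; apply: le_trans (hS _) _.
  rewrite -(ler_pM2l kS0) in h; apply: le_trans h _.
  have -> : kS * ((2 * kS)^-1 * nm v) = nm v / 2 by field; rewrite gt_eqF.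
  exact: lexx.
have dinj y : nm (y - a) < r -> lin1_mx ('d f y) \in unitmx.
  move=> yr; apply: J_unit => v v0; apply/nm_eq0/eqP; rewrite eq_le nm_ge0 andbT.
  have := close y v yr; rewrite v0 mul0mx sub0r nmN; move: (nm v); clear => x; lra.
have hpsi y y' : nm (y - a) < r -> nm (y' - a) < r ->
    nm (psi y - psi y') <= nm (y - y') / 2.
  move=> yr y'r; have -> : psi y = psi (y' + (y - y')) by rewrite addrC subrK.
  apply: mean_value_mx => t t01.
  set z := y' + _; have zr : nm (z - a) < r by apply: ball_segment.
  have dz : differentiable f z by apply: (hf z _).1; have [] := hr z zr.
  have [d1 e1] := diff_mulmxr S dz.
  have did := differentiable_idfun z.
  split; first exact: (differentiableB d1 did).
  have -> : 'd psi z (y - y') = 'd f z (y - y') *m S - (y - y').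
    apply: etrans (diffB_apply (y - y') d1 did) _.
    by congr (_ - _); [exact: e1 | exact: diff_id_apply].
  exact: close.
pose O2 := [set w | nm (w *m S - f a *m S) < r / 2].
have oO2 : open O2.
  have -> : O2 = (fun w => w *m S) @^-1` [set z | nm (z - f a *m S) < r / 2] by [].
  have /continuousP : continuous (mulmxr S : 'rV[C]_n -> 'rV[C]_n).
    exact: (@continuous_linear_mx C 1 n 'rV[C]_n (mulmxr S)).
  apply; rewrite openE => z zr; apply/nbhs_nmP; exists (r / 2 - nm (z - f a *m S)).
    by rewrite subr_gt0.
  move=> y yz /=.
  have -> : y - f a *m S = (y - z) + (z - f a *m S) by rewrite addrA subrK.
  by apply: le_lt_trans (nmD _ _) _; rewrite -ltrBrDr.
have ex w : O2 w -> exists y, nm (y - a) < r /\ f y = w.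
  move=> w2; have [||y yr ey] := @perturbed_identity_onto 1 n psi a (w *m S) r.
  - exact: hpsi.
  - rewrite /psi opprB [a - _]addrC addrA addrK mulrC -ltr_pdivlMr //.
  exists y; split => //; apply: (can_inj (mulmxKV (J_unit a inj))).
  by rewrite -/S -ey /psi addrC subrK.
pose h w := get [set y | nm (y - a) < r /\ f y = w].
have hP w : O2 w -> nm (h w - a) < r /\ f (h w) = w.
  by move=> /ex/cid[y hy]; exact: (@getPex _ [set y | nm (y - a) < r /\ f y = w] (ex_intro _ y hy)).
have lip w w' : O2 w -> O2 w' -> nm (h w - h w') <= 2 * kS * nm (w - w').
  move=> /hP[wr fw] /hP[wr' fw'].
  have le1 := hpsi _ _ wr wr'.
  have le2 : nm (h w - h w') <= nm ((w - w') *m S) + nm (psi (h w) - psi (h w')).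
    have -> : h w - h w' = (w - w') *m S - (psi (h w) - psi (h w')).
      rewrite /psi fw fw' mulmxBl !opprB [RHS]addrA.
      by rewrite [w *m S - _ + _]addrA subrK [RHS]addrC addrA subrK.
    exact: nmB.
  have le3 : nm ((w - w') *m S) <= kS * nm (w - w') := hS (w - w').
  move: le1 le2 le3; move: (nm _) (nm _) (nm _) (nm _); clear => X1 X2 X3 X4; lra.
exists O2, h; split; first exact: oO2.
- by rewrite /O2 /= subrr nm0 divr_gt0.
- pose T w := lin1_mx ('d f (h w)).
  have uT w : O2 w -> T w \in unitmx by move=> /hP[/dinj].
  have dh w : O2 w -> differentiable h w /\
      'd h w = mulmxr (invmx (T w)) :> ('rV[C]_n -> 'rV[C]_n).
    move=> w2; have [wr fw] := hP w w2.
    pose D : {linear 'rV[C]_n -> 'rV[C]_n} := mulmxr (invmx (T w)).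
    apply: (diff_of_remainder (L := D)).
      exact: (@continuous_linear_mx C 1 n 'rV[C]_n D).
    move=> e e0'; have [kD kD0 hD] := linear_bound D.
    have L0 : 0 < 2 * kS by rewrite mulr_gt0.
    have e'0 : 0 < e / (kD * (2 * kS)) by rewrite divr_gt0 ?mulr_gt0.
    have dfw : differentiable f (h w) by apply: (hf _ _).1; have [] := hr _ wr.
    have [d d0 hd] := nm_diff dfw e'0.
    have /nbhs_nmP[d2 d20 hd2] : nbhs w O2 by exact: open_nbhs_nbhs.
    exists (Num.min d2 (d / (2 * kS))); first by rewrite lt_min d20 divr_gt0.
    move=> w'; rewrite lt_min => /andP[/hd2 w'2 w'd].
    have l := lip _ _ w'2 w2.
    have [_ fw'] := hP w' w'2.
    have hwd : nm (h w' - h w) < d.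
      by apply: le_lt_trans l _; rewrite mulrC -ltr_pdivlMr.
    have -> : h w' - h w - D (w' - w) = - D (f (h w') - f (h w) - 'd f (h w) (h w' - h w)).
      have DK u : D ('d f (h w) u) = u by rewrite dfE /= mulmxK // uT.
      by rewrite fw fw' (linearB D (w' - w)) opprB DK.
    rewrite nmN; apply: le_trans (hD _) _.
    apply: (@le_trans _ _ (kD * (e / (kD * (2 * kS)) * (2 * kS * nm (w' - w))))).
      rewrite ler_pM2l //; apply: le_trans (hd _ hwd) _.
      by rewrite ler_pM2l.
    have -> : kD * (e / (kD * (2 * kS)) * (2 * kS * nm (w' - w))) = e * nm (w' - w).
      by field; rewrite !gt_eqF.
    exact: lexx.
  refine (@C1_formula _ _ _ O2 h (fun w v => v *m invmx (T w)) oO2 _ _ _) => w.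
  + by move=> /dh[].
  + by move=> v /dh[_ ->].
  + move=> v w2; apply: (@continuous_comp _ _ _ (fun w => invmx (T w)) (mulmx v)); last first.
      exact: (@continuous_linear_mx C n n 'rV[C]_n (mulmx v)).
    apply: (@continuous_comp _ _ _ T (@invmx C n)); last exact: continuous_invmx (uT w w2).
    apply: continuous_mx => i j.
    rewrite (_ : (fun y => T y i j) = fun y => 'd f (h y) (delta_mx 0 i) 0 j); last first.
      by apply/funext => y; rewrite !mxE.
    apply: (@continuous_comp _ _ _ (fun y => 'd f (h y) (delta_mx 0 i))
      (fun M : 'rV[C]_n => M 0 j)); last exact: coord_continuous.
    apply: (@continuous_comp _ _ _ h (fun y => 'd f y (delta_mx 0 i))).
      by apply: differentiable_continuous; have [] := dh w w2.
    by apply: (hf _ _).2; have [/hr[]] := hP w w2.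
- by move=> w /hP[/hr[]].
Qed.

End InverseFunction.

(** * Graphs of matrices as linear subspaces *)

Section MatrixSubspaces.
Variable F : fieldType.

Lemma vspace_row_matrix n (T : {vspace 'rV[F]_n}) :
  exists2 B : 'M[F]_(\dim T, n), row_free B & forall v, (v \in T) = (v <= B)%MS.
Proof.
pose B := \matrix_(i < \dim T) (vbasis T)`_i.
have rB i : row i B = (vbasis T)`_i by rewrite rowK.
have mulB (c : 'rV_(\dim T)) : c *m B = \sum_i c 0 i *: (vbasis T)`_i.
  by rewrite mulmx_sum_row; apply: eq_bigr => i _; rewrite rB.
exists B.
  rewrite -kermx_eq0; apply/eqP/row_matrixP => i; rewrite row0.
  have := congr1 (row i) (mulmx_ker B); rewrite row_mul row0 mulB => h.
  have /freeP fT := basis_free (vbasisP T).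
  by apply/rowP => j; rewrite [RHS]mxE; exact: (fT _ h j).
move=> v; apply/idP/submxP => [/coord_vbasis vE|[c ->]].
  exists (\row_i coord (vbasis T) i v); rewrite mulB vE.
  by apply: eq_bigr => i _; rewrite mxE -vE.
rewrite mulB; apply: memv_suml => i _; apply: memvZ.
by apply: vbasis_mem; rewrite mem_nth ?size_tuple.
Qed.

Lemma mem_span_rows n k (B : 'M[F]_(k, n)) v :
  (v \in <<[seq row i B | i <- enum 'I_k]>>%VS) = (v <= B)%MS.
Proof.
apply/idP/submxP => [|[c ->]].
  rewrite span_def big_map big_enum /= => /memv_sumP[u uP ->].
  have /fin_all_exists[c cP] i : exists a, u i = a *: row i B.
    by apply/vlineP; exact: uP.
  exists (\row_i c i); rewrite mulmx_sum_row; apply: eq_bigr => i _.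
  by rewrite cP mxE.
rewrite mulmx_sum_row; apply: memv_suml => i _; apply: memvZ; apply: memv_span.
by apply: map_f; rewrite mem_enum.
Qed.

Lemma dim_row_space n k (B : 'M[F]_(k, n)) (T : {vspace 'rV[F]_n}) :
  (forall v, (v \in T) = (v <= B)%MS) -> \dim T = \rank B.
Proof.
move=> TB; have [B' fB' TB'] := vspace_row_matrix T.
have <- : \rank B' = \dim T by apply/eqP.
apply/eqP; rewrite eqn_leq; apply/andP; split; apply: mxrankS; apply/row_subP => i.
  by rewrite -TB TB' row_sub.
by rewrite -TB' TB row_sub.
Qed.


(** Square matrices with a left inverse are invertible. *)
Lemma onto_injective k (J : {linear 'rV[F]_k -> 'rV[F]_k}) :
  (forall u, exists v, J v = u) -> forall v, J v = 0 -> v = 0.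
Proof.
move=> onto.
pose B := \matrix_i sval (cid (onto (delta_mx 0 i))).
have BJ : B *m lin1_mx J = 1%:M.
  apply/row_matrixP => i; rewrite row_mul rowK mul_rV_lin1 row1.
  by case: cid.
move=> v Jv; rewrite -[v]mulmx1 -(mulmx1C BJ) mulmxA mul_rV_lin1 Jv.
exact: mul0mx.
Qed.

Section Graphs.
Variables n p q : nat.
Implicit Types (P : 'M[F]_(n, p)) (Q : 'M[F]_(n, q)) (A : 'M[F]_(p, q)).

(** The columns of P and Q are coordinate functions, the rows of B1 and B2 the dual
basis of vectors. *)
Definition dual_frame P Q (B1 : 'M[F]_(p, n)) (B2 : 'M[F]_(q, n)) :=
  [/\ P *m B1 + Q *m B2 = 1%:M, B1 *m P = 1%:M, B1 *m Q = 0, B2 *m P = 0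
    & B2 *m Q = 1%:M].

(** Its columns span the linear forms vanishing on the graph v Q = v P A. *)
Definition normal P Q A : 'M[F]_(n, q) := Q - P *m A.

Definition graphv P Q A : {vspace 'rV[F]_n} :=
  lker (linfun (mulmxr (normal P Q A))).

Lemma mem_graphv P Q A v : (v \in graphv P Q A) = (v *m normal P Q A == 0).
Proof. by rewrite memv_ker lfunE. Qed.

Lemma mem_graphvE P Q A v : (v \in graphv P Q A) = (v *m Q == v *m P *m A).
Proof. by rewrite mem_graphv mulmxBr mulmxA subr_eq0. Qed.

Section Frame.
Variables (P : 'M[F]_(n, p)) (Q : 'M[F]_(n, q)).
Variables (B1 : 'M[F]_(p, n)) (B2 : 'M[F]_(q, n)).
Hypothesis fr : dual_frame P Q B1 B2.

(** Its rows are the vectors of the graph of A over the coordinate basis. *)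
Definition lift A : 'M[F]_(p, n) := B1 + A *m B2.

Lemma lift_fst A : lift A *m P = 1%:M.
Proof. by case: fr => _ h1 _ h3 _; rewrite /lift mulmxDl -mulmxA h1 h3 mulmx0 addr0. Qed.

Lemma lift_snd A : lift A *m Q = A.
Proof. by case: fr => _ _ h2 _ h4; rewrite /lift mulmxDl -mulmxA h2 h4 mulmx1 add0r. Qed.

Lemma lift_normal A A' : lift A *m normal P Q A' = A - A'.
Proof. by rewrite mulmxBr mulmxA lift_fst lift_snd mul1mx. Qed.

Lemma lift_shift A A' : lift A = lift A' + (A - A') *m B2.
Proof. by rewrite /lift mulmxBl -[RHS]addrA [_ + (_ - _)]addrC subrK. Qed.

Lemma dual_normal A : B2 *m normal P Q A = 1%:M.
Proof. by case: fr => _ _ _ h3 h4; rewrite mulmxBr mulmxA h3 h4 mul0mx subr0. Qed.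

Lemma graphvP A v : (v \in graphv P Q A) = (v <= lift A)%MS.
Proof.
rewrite mem_graphv; apply/eqP/submxP => [vn|[c ->]]; last first.
  by rewrite -mulmxA lift_normal subrr mulmx0.
exists (v *m P); move: vn; rewrite mulmxBr mulmxA => /subr0_eq vQ.
case: fr => h _ _ _ _.
by rewrite mulmxDr !mulmxA -vQ -!mulmxA -mulmxDr h mulmx1.
Qed.

Lemma dim_graphv A : \dim (graphv P Q A) = p.
Proof.
rewrite (dim_row_space (graphvP A)); apply/eqP.
by apply/row_freeP; exists P; exact: lift_fst.
Qed.

Lemma graphv_inj A A' : graphv P Q A = graphv P Q A' -> A = A'.
Proof.
move=> e; apply/subr0_eq; rewrite -lift_normal; apply/row_matrixP => i.
rewrite row0 row_mul; apply/eqP; rewrite -mem_graphv -e graphvP.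
exact: row_sub.
Qed.

(** The equation says that the first coordinates of [u] are determined by the last
ones. *)
Lemma annihilator_graph r A (u : 'M[F]_(n, r)) :
  lift A *m u = 0 -> u = normal P Q A *m (B2 *m u).
Proof.
case: fr => h _ _ _ _; rewrite /lift mulmxDl -mulmxA => /eqP; rewrite addr_eq0 => /eqP e.
rewrite -{1}[u]mul1mx -h mulmxDl -!mulmxA e mulmxN mulmxBl addrC.
by rewrite !mulmxA.
Qed.

End Frame.

End Graphs.

Lemma dual_frame_ex n p q (P : 'M[F]_(n, p)) (Q : 'M[F]_(n, q)) : n = (p + q)%N -> row_free (row_mx P Q) ->
  exists B1 B2, dual_frame P Q B1 B2.
Proof.
move=> e; subst n =>  /row_freeP[B PQB].
exists (usubmx B), (dsubmx B).
have := PQB; rewrite -{1}[B]vsubmxK mul_row_col => e1.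
have := mulmx1C PQB; rewrite -{1}[B]vsubmxK mul_col_row scalar_mx_block.
by case/eq_block_mx => e2 e3 e4 e5; split.
Qed.

(** Gaussian elimination of a basis of [T] provides coordinates of which the last q
vanish exactly on [T]. *)
Lemma adapted_frame n p q (T : {vspace 'rV[F]_n}) : n = (p + q)%N -> \dim T = p ->
  exists (P : 'M[F]_(n, p)) (Q : 'M[F]_(n, q)), row_free (row_mx P Q) /\ T = graphv P Q 0.
Proof.
move=> en; subst n => dT; have [B fB TB] := vspace_row_matrix T.
have rB : \rank B = p by rewrite (eqP fB).
pose E := invmx (row_ebase B).
have uE : E \in unitmx by rewrite unitmx_inv row_ebase_unit.
exists (lsubmx E), (rsubmx E); rewrite hsubmxK; split; first by rewrite row_free_unit.
apply/vspaceP => v; rewrite TB mem_graphv /normal mulmx0 subr0 submxE.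
rewrite /cokermx -/E rB mulmxA -[v *m E]hsubmxK.
have -> : copid_mx p = block_mx 0 0 0 1%:M :> 'M[F]_(p + q).
  by rewrite /copid_mx pid_mx_block scalar_mx_block opp_block_mx add_block_mx
       !oppr0 !addr0 subrr.
rewrite mul_row_block !mulmx0 mulmx1 !add0r -row_mx0.
rewrite -mulmx_rsub; apply/eqP/eqP => [/eq_row_mx[] //|->] //.
Qed.

End MatrixSubspaces.

(** * Co-gamma-planes in affine charts *)

Lemma eq_shift (Z : zmodType) (a b c d e : Z) :
  a = b + e -> c = d + e <-> c - a = d - b.
Proof.
move=> ->; split=> [->|]; first by rewrite opprD addrACA subrr addr0.
by move=> /(congr1 (fun z => z + (b + e))); rewrite subrK addrA subrK.
Qed.

Section MiniTwistorSpace.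
Variables (R : realType) (m : nat).
Local Notation C := (Cplx R).
Local Notation n := (2 * m).+1.
Local Notation V := 'rV[C]_n.
Implicit Types (T : {vspace V}) (x y u v : V).

Lemma dim_split : n = (m.+1 + m)%N.
Proof. by rewrite mul2n -addnn. Qed.

Lemma g_mulmx u v : g u v = 0 <-> u *m v^T = 0.
Proof.
rewrite /g; split => [h|->]; last by rewrite mxE.
by apply/matrixP => i j; rewrite !ord1 h mxE.
Qed.

Lemma perp_rows k (B : 'M[C]_(k, n)) T u :
  (forall v, (v \in T) = (v <= B)%MS) -> (u \in perp T) = (u *m B^T == 0).
Proof.
move=> TB; apply/perpP/eqP => [h|uB v]; last first.
  by rewrite TB => /submxP[c ->]; apply/g_mulmx; rewrite trmx_mul mulmxA uB mul0mx.
apply: (can_inj (@trmxK _ _ _)); rewrite trmx_mul trmxK trmx0.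
apply/row_matrixP => i; rewrite row0 row_mul.
apply: (can_inj (@trmxK _ _ _)); rewrite trmx_mul trmxK trmx0.
by apply/g_mulmx/h; rewrite TB row_sub.
Qed.

Lemma dim_perp T : \dim (perp T) = (n - \dim T)%N.
Proof.
have [B fB TB] := vspace_row_matrix T.
have pE u : (u \in perp T) = (u <= kermx B^T)%MS.
  by rewrite (perp_rows _ TB); apply/eqP/sub_kermxP.
by rewrite (dim_row_space pE) mxrank_ker mxrank_tr (eqP fB).
Qed.

(** One inclusion is symmetry of g, and g is nondegenerate, so the dimensions agree. *)
Lemma perpK T : perp (perp T) = T.
Proof.
apply/esym/eqP; rewrite eqEdim; apply/andP; split.
  apply/subvP => v vT; apply/perpP => u /perpP/(_ v vT)/g_mulmx h.
  by apply/g_mulmx; apply: (can_inj (@trmxK _ _ _)); rewrite trmx_mul trmxK h trmx0.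
rewrite !dim_perp subKn //.
by have := dimvS (subvf T); rewrite dimvf /dim /= mul1n.
Qed.

Section Frame.
Variables (P : 'M[C]_(n, m.+1)) (Q : 'M[C]_(n, m)).
Variables (B1 : 'M[C]_(m.+1, n)) (B2 : 'M[C]_(m, n)).
Hypothesis fr : dual_frame P Q B1 B2.

Lemma perp_graph A u :
  (u \in perp (graphv P Q A)) = (u <= (normal P Q A)^T)%MS.
Proof.
rewrite (perp_rows _ (graphvP fr A)); apply/eqP/submxP => [h|[c ->]].
  exists (u *m B2^T).
  have /(annihilator_graph fr) e : lift B1 B2 A *m u^T = 0.
    by apply: (can_inj (@trmxK _ _ _)); rewrite trmx_mul trmxK trmx0.
  by rewrite -{1}[u]trmxK e !trmx_mul trmxK.
rewrite -mulmxA; have -> : (normal P Q A)^T *m (lift B1 B2 A)^T = 0.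
  by rewrite -trmx_mul (lift_normal fr) subrr trmx0.
by rewrite mulmx0.
Qed.

(** The orthogonal complement of a graph is spanned by its normals, so nullity is the
vanishing of their Gram matrix. *)
Lemma perp_graph_null A :
  totally_null (perp (graphv P Q A)) <-> (normal P Q A)^T *m normal P Q A = 0.
Proof.
split => [h|h u v]; last first.
  rewrite !perp_graph => /submxP[c ->] /submxP[d ->]; apply/g_mulmx.
  by rewrite trmx_mul trmxK mulmxA -(mulmxA c) h mulmx0 mul0mx.
apply/row_matrixP => i; rewrite row0 row_mul.
apply: (can_inj (@trmxK _ _ _)); rewrite trmx0; apply/row_matrixP => j.
rewrite row0 trmx_mul row_mul.
apply/g_mulmx/h; rewrite perp_graph row_sub //.
Qed.

End Frame.

Lemma affine_subspace_refl x T : affine_subspace x T x.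
Proof. by rewrite /affine_subspace /= subrr mem0v. Qed.

Lemma affine_subspace_inj x y T T' :
  affine_subspace x T = affine_subspace y T' -> T = T'.
Proof.
move=> e.
have xT' : x - y \in T' by have := affine_subspace_refl x T; rewrite e.
apply/vspaceP => v; apply/idP/idP => [vT|vT'].
  have : affine_subspace x T (x + v) by rewrite /affine_subspace /= addrC addKr.
  rewrite e /affine_subspace /= => h.
  by have := memvB h xT'; rewrite opprB addrA subrK addrC addKr.
have : affine_subspace y T' (x + v).
  by rewrite /affine_subspace /= addrAC; apply: memvD.
by rewrite -e /affine_subspace /= addrC addKr.
Qed.

Lemma affine_subspace_eq x y T : y - x \in T -> affine_subspace y T = affine_subspace x T.
Proof.
move=> h; apply/funext => z; apply/propext; rewrite /affine_subspace /=; split => hz.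
  by have := memvD hz h; rewrite addrA subrK.
by have := memvB hz h; rewrite opprB addrA subrK.
Qed.

Lemma MT_affine x T :
  MT (affine_subspace x T) <-> \dim T = m.+1 /\ totally_null (perp T).
Proof.
split => [[y [T' [e d t]]]|[d t]]; last by exists x, T.
by rewrite (affine_subspace_inj e).
Qed.

(** An affine subspace may be based at any of its points. *)
Lemma MT_through (S : set V) x : MT S -> S x -> exists T,
  [/\ S = affine_subspace x T, \dim T = m.+1 & totally_null (perp T)].
Proof.
move=> [y [T [-> d t]]] xT; exists T; split => //.
by apply/esym/affine_subspace_eq; exact: xT.
Qed.

Lemma chart_plane_affine (P : 'M[C]_(n, m.+1)) (Q : 'M[C]_(n, m))
    (M : 'M[C]_(m.+1 + 1, m)) x : chart_plane P Q M x ->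
  chart_plane P Q M = affine_subspace x (graphv P Q (usubmx M)).
Proof.
have mE y : row_mx (y *m P) 1%:M *m M = y *m P *m usubmx M + dsubmx M.
  by rewrite -{1}[M]vsubmxK mul_row_col mul1mx.
rewrite /chart_plane /= mE => xM; apply/funext => y; apply/propext => /=.
rewrite mE /affine_subspace /= mem_graphvE !mulmxBl.
by split => [/(eq_shift _ _ xM)/eqP | /eqP/(eq_shift _ _ xM)].
Qed.

Lemma chart_planeE (P : 'M[C]_(n, m.+1)) (Q : 'M[C]_(n, m)) A x :
  chart_plane P Q (col_mx A (x *m Q - x *m P *m A)) = affine_subspace x (graphv P Q A).
Proof.
rewrite (@chart_plane_affine _ _ _ x) ?col_mxKu //.
by rewrite /chart_plane /= mul_row_col mul1mx addrC subrK.
Qed.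

Lemma chart_frame (P : 'M[C]_(n, m.+1)) (Q : 'M[C]_(n, m)) : chart P Q -> exists B1 B2, @dual_frame C n m.+1 m P Q B1 B2.
Proof. by apply: dual_frame_ex; exact: dim_split. Qed.

(** In every chart the mini-twistor space is cut out by the quadratic equation saying
that the normals are isotropic. *)
Lemma chart_plane_MT (P : 'M[C]_(n, m.+1)) (Q : 'M[C]_(n, m))
    (M : 'M[C]_(m.+1 + 1, m)) : chart P Q ->
  MT (chart_plane P Q M) <->
  (normal P Q (usubmx M))^T *m normal P Q (usubmx M) = 0.
Proof.
move=> /chart_frame[B1 [B2 fr]].
have [_ h1 h2 h3 h4] := fr.
pose x : V := dsubmx M *m B2.
have xM : chart_plane P Q M x.
  rewrite /chart_plane /= -{1}[M]vsubmxK mul_row_col mul1mx /x.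
  by rewrite -!mulmxA h4 (mulmxA B2) h3 mul0mx mulmx0 add0r mulmx1.
rewrite (chart_plane_affine xM) MT_affine (dim_graphv fr).
by rewrite (perp_graph_null fr); split => // -[].
Qed.

End MiniTwistorSpace.

(** * Curves of isotropic subspaces *)

Section IsotropicCurves.
Variable K : numFieldType.

(** A linear map w prescribed on the column space of N extends to a skew matrix as
soon as the form it induces on that space is skew; j is a left inverse of N, and
the last term removes the contribution counted twice. *)
Lemma skew_extension n q (w N : 'M[K]_(n, q)) (j : 'M[K]_(q, n)) :
  j *m N = 1%:M -> w^T *m N = - (N^T *m w) ->
  let X := w *m j - j^T *m w^T - j^T *m (N^T *m w) *m j in
  X *m N = w /\ X^T = - X.
Proof.
move=> jN wN X; split.
  rewrite /X !mulmxBl -!mulmxA jN !mulmx1 wN mulmxN opprK.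
  by rewrite -addrA subrr addr0.
rewrite /X !(raddfB, raddfN) /= !trmx_mul !trmxK -!mulmxA.
rewrite [w^T *m _]mulmxA wN mulNmx mulmxN !opprK !mulmxA.
by rewrite [j^T *m w^T - _]addrC.
Qed.

Lemma eq_mulmx_diff (E : normedModType K) n p q r (O : set E) x v
    (f : E -> 'M[K]_(n, p)) (h : E -> 'M[K]_(p, q))
    (f' : E -> 'M[K]_(n, r)) (h' : E -> 'M[K]_(r, q)) :
  open O -> O x -> (forall y, O y -> f y *m h y = f' y *m h' y) ->
  differentiable f x -> differentiable h x ->
  differentiable f' x -> differentiable h' x ->
  'd f x v *m h x + f x *m 'd h x v = 'd f' x v *m h' x + f' x *m 'd h' x v.
Proof.
move=> oO Ox e df dh df' dh'.
have [d1 e1] := diff_mulmx df dh; have [d2 e2] := diff_mulmx df' dh'.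
by rewrite -e1 -e2; apply: (eq_on_diff v oO Ox _ d2) => y /e.
Qed.

(** Differentiated form of U nu = U' N at a point where U = 1. *)
Lemma cayley_velocity n q (dU dU' u u' Y : 'M[K]_n) (N0 N dN z : 'M[K]_(n, q)) :
  dU *m N0 + u *m dN = dU' *m N + u' *m z ->
  dU = - Y -> dU' = Y -> u = 1%:M -> N0 = N -> z = 0 -> dN = Y *m N + Y *m N.
Proof.
move=> h e1 e2 e3 e4 e5; move: h; rewrite e1 e2 e3 e4 e5 => /eqP.
by rewrite mulmx0 addr0 mul1mx mulNmx addrC subr_eq => /eqP.
Qed.

(** Differentiated form of c (B2 nu) = B1 nu. *)
Lemma quotient_velocity n p q (dc c0 c : 'M[K]_(p, q)) (z B1 : 'M[K]_(p, n))
    (B2 : 'M[K]_(q, n)) (N0 dN : 'M[K]_(n, q)) (dB : 'M[K]_q) :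
  dc *m (B2 *m N0) + c0 *m dB = z *m N0 + B1 *m dN ->
  z = 0 -> c0 = c -> dB = B2 *m dN ->
  dc *m (B2 *m N0) = B1 *m dN - c *m (B2 *m dN).
Proof.
move=> h e1 e2 e3; move: h; rewrite e1 e2 e3 mul0mx add0r => <-.
by rewrite addrK.
Qed.

Section Cayley.
Variables n p q : nat.
Variables (P : 'M[K]_(n, p)) (Q : 'M[K]_(n, q)).
Variables (B1 : 'M[K]_(p, n)) (B2 : 'M[K]_(q, n)).
Hypothesis fr : dual_frame P Q B1 B2.

Lemma fst_normal A : B1 *m normal P Q A = - A.
Proof.
by case: fr => _ h1 h2 _ _; rewrite mulmxBr mulmxA h1 h2 mul1mx sub0r.
Qed.

(** A frame of columns differs from the normals of a graph by the invertible block of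
its last coordinates. *)
Lemma normal_of_columns (nu : 'M[K]_(n, q)) : B2 *m nu \in unitmx ->
  normal P Q (- (B1 *m nu *m invmx (B2 *m nu))) *m (B2 *m nu) = nu.
Proof.
move=> u; rewrite /normal mulmxN opprK mulmxDl -!mulmxA mulVmx // mulmx1.
by case: fr => h _ _ _ _; rewrite !mulmxA addrC -mulmxDl h mul1mx.
Qed.

(** The velocity [a] moves the normals N by - P a.  By [skew_extension] a skew X does
the same, and its Cayley transforms (1 - t X / 2)^-1 (1 + t X / 2) are orthogonal,
so they carry N through isotropic frames.  Renormalising these frames gives the
matrices c t. *)
Lemma isotropic_curve A a :
  (normal P Q A)^T *m normal P Q A = 0 ->
  ((normal P Q A)^T *m P *m a)^T = - ((normal P Q A)^T *m P *m a) ->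
  exists (O : set K^o) (c : K^o -> 'M[K]_(p, q)),
    [/\ open O, O 0, C1_on O c, c 0 = A /\ 'd c 0 1 = a
      & forall t, O t -> (normal P Q (c t))^T *m normal P Q (c t) = 0].
Proof.
set N := normal P Q A => NN Na.
pose w := - (P *m a).
pose X := w *m B2 - B2^T *m w^T - B2^T *m (N^T *m w) *m B2.
have wN : w^T *m N = - (N^T *m w).
  by rewrite /w linearN /= mulNmx mulmxN opprK mulmxA -[RHS]opprK -Na -mulmxA
    [(N^T *m _)^T]trmx_mul trmxK.
have B2N : B2 *m N = 1%:M := dual_normal fr A.
have [XN XT] : X *m N = w /\ X^T = - X := skew_extension B2N wN.
pose Y := 2^-1 *: X.
pose U := fun t : K^o => 1%:M + t *: (- Y).
pose U' := fun t : K^o => 1%:M + t *: Y.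
have YT : (- Y)^T = Y by rewrite /Y linearN linearZ /= XT scalerN opprK.
have UT t : (U t)^T = U' t by rewrite /U linearD /= trmx1 linearZ /= YT.
have UU t : U t *m U' t = U' t *m U t.
  rewrite /U /U' scalerN; set Z := t *: Y.
  by rewrite mulmxBl mulmxBr mul1mx mulmx1 mulmxDr mulmxDl mulmx1 mul1mx.
have C1U : C1_on setT U by exact: C1_line openT.
have C1U' : C1_on setT U' by exact: C1_line openT.
pose O1 := [set t | U t \in unitmx].
have oO1 : open O1.
  have := open_C1_preimage openT C1U (@open_unitmx K n).
  by congr open; apply/funext => t; apply/propext; split => [[]|].
pose nu := fun t => invmx (U t) *m (U' t *m N).
have C1nu : C1_on O1 nu.
  apply: (C1_mulmx oO1); first by apply: (C1_invmx oO1) => //; exact: C1_sub C1U.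
  by apply: (C1_mulmx oO1); [exact: C1_sub C1U' | exact: C1_cst].
pose O := [set t | O1 t /\ B2 *m nu t \in unitmx].
have C1B r (B : 'M[K]_(r, n)) : C1_on O1 (fun t => B *m nu t).
  by apply: (C1_mulmx oO1) => //; exact: C1_cst.
have oO : open O := open_C1_preimage oO1 (C1B _ B2) (@open_unitmx K q).
pose c := fun t => - (B1 *m nu t *m invmx (B2 *m nu t)).
have OO1 : O `<=` O1 by move=> t [].
have C1c : C1_on O c.
  apply: (C1N oO); apply: (C1_mulmx oO); first exact: C1_sub (C1B _ B1).
  by apply: (C1_invmx oO); [move=> t [] | exact: C1_sub (C1B _ B2)].
have U0 : U 0 = 1%:M by rewrite /U scale0r addr0.
have U'0 : U' 0 = 1%:M by rewrite /U' scale0r addr0.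
have nu0 : nu 0 = N by rewrite /nu U0 U'0 invmx1 !mul1mx.
have O10 : O1 0 by rewrite /O1 /= U0 unitmx1.
have O0 : O 0 by split => //; rewrite nu0 B2N unitmx1.
have c0 : c 0 = A by rewrite /c nu0 B2N invmx1 mulmx1 fst_normal opprK.
exists O, c; split; [exact: oO|exact: O0|exact: C1c| | ]; last first.
  move=> t [t1 ut]; rewrite /O1 /= in t1.
  have uT : U' t \in unitmx by rewrite -UT unitmx_tr.
  have nn : (nu t)^T *m nu t = 0.
    have e : invmx (U' t) *m invmx (U t) = invmx (U t) *m invmx (U' t).
      apply: (can_inj (mulKmx t1)); apply: (can_inj (mulKmx uT)).
      rewrite (mulKVmx t1) (mulmxV uT) !mulmxA -UU -mulmxA.
      by rewrite -(mulmxA _ (U' t)) (mulmxA (U' t)) mulmxV // mul1mx mulmxV.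
    rewrite /nu trmx_mul trmx_inv UT [(U' t *m N)^T]trmx_mul -(UT t) trmxK UT.
    rewrite -!mulmxA (mulmxA (invmx (U' t))) e -!mulmxA (mulKmx uT).
    by rewrite (mulKVmx t1).
  have -> : normal P Q (c t) = nu t *m invmx (B2 *m nu t).
    by rewrite -{1}(normal_of_columns ut) mulmxK.
  by rewrite trmx_mul -[LHS]mulmxA (mulmxA (nu t)^T (nu t)) nn mul0mx mulmx0.
split; first exact: c0.
have dnu : differentiable nu 0 by have [] := C1nu 0 O10.
have dc : differentiable c 0 by have [] := C1c 0 O0.
have nu' : 'd nu 0 1 = w.
  have dU : differentiable U 0 by have [] := C1U 0 I.
  have dU' : differentiable U' 0 by have [] := C1U' 0 I.
  have e12 t : O1 t -> U t *m nu t = U' t *m N.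
    by move=> O1t; rewrite /nu mulKVmx.
  have eU : 'd U 0 1 = - Y := etrans (diff_line _ _ _ _) (scale1r _).
  have eU' : 'd U' 0 1 = Y := etrans (diff_line _ _ _ _) (scale1r _).
  have H := eq_mulmx_diff (1 : K^o) oO1 O10 e12 dU dnu dU' (differentiable_cst N 0).
  rewrite (cayley_velocity H eU eU' U0 nu0 (diff_cst_apply N (0 : K^o) 1)).
  have half : 2^-1 + 2^-1 = 1 :> K by rewrite -div1r -splitr.
  by rewrite -mulmxDl /Y -scalerDl half scale1r.
have [dB1 eB1] := diff_mulmxl B1 dnu.
have [dB2 eB2] := diff_mulmxl B2 dnu.
have e12 t : O t -> c t *m (B2 *m nu t) = - B1 *m nu t.
  by move=> [_ ut]; rewrite /c !mulNmx mulmxKV.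
have H0 := eq_mulmx_diff (1 : K^o) oO O0 e12 dc dB2 (differentiable_cst (- B1) 0) dnu.
have := quotient_velocity H0 (diff_cst_apply (- B1) (0 : K^o) 1) c0 (eB2 1).
have [_ h1 _ h3 _] := fr.
have B2w : B2 *m w = 0 by rewrite /w mulmxN mulmxA h3 mul0mx oppr0.
have B1w : - B1 *m w = a by rewrite /w mulmxN mulNmx opprK mulmxA h1 mul1mx.
by rewrite nu0 nu' B2N mulmx1 B2w mulmx0 subr0 B1w.
Qed.

End Cayley.

(** Differentiate the equation of isotropy of the normals. *)
Lemma isotropic_velocity n p q (P : 'M[K]_(n, p)) (Q : 'M[K]_(n, q)) (O : set K^o)
    (A : K^o -> 'M[K]_(p, q)) (t : K^o) :
  open O -> O t -> differentiable A t ->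
  (forall s, O s -> (normal P Q (A s))^T *m normal P Q (A s) = 0) ->
  let v := (normal P Q (A t))^T *m P *m 'd A t 1 in v^T = - v.
Proof.
move=> oO Ot dA hA v.
have [dPA ePA] := diff_mulmxl P dA.
have dN : differentiable (fun s => normal P Q (A s)) t.
  exact: (differentiableB (differentiable_cst Q t) dPA).
have eN : 'd (fun s => normal P Q (A s)) t 1 = - (P *m 'd A t 1).
  apply: etrans (diffB_apply (1 : K^o) (differentiable_cst Q t) dPA) _.
  exact: (etrans (f_equal2 (fun a b => a - b) (diff_cst_apply Q t (1 : K^o)) (ePA 1)) (sub0r _)).
pose tr : {linear 'M[K]_(n, q) -> 'M[K]_(q, n)} := @trmx K n q.
have dtr : differentiable tr (normal P Q (A t)) by case: (is_diff_linear_mx tr (normal P Q (A t))).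
have dNt : differentiable (fun s => (normal P Q (A s))^T) t := differentiable_comp dN dtr.
have eNt : 'd (fun s => (normal P Q (A s))^T) t 1 = - (P *m 'd A t 1)^T.
  apply: etrans (diff_comp_apply (1 : K^o) dN dtr) _.
  by rewrite diff_linear_mx_apply /= eN linearN.
have [d1 e1] := diff_mulmx dNt dN.
have e0 : 'd (fun s => (normal P Q (A s))^T *m normal P Q (A s)) t 1 = 0.
  have := eq_on_diff (1 : K^o) oO Ot (fun s Os => esym (hA s Os)) (differentiable_cst 0 t).
  by move=> ->; exact: diff_cst_apply.
have vE : v^T = (P *m 'd A t 1)^T *m normal P Q (A t).
  by rewrite /v -mulmxA trmx_mul trmxK.
have := etrans (esym (e1 1)) e0; rewrite eN eNt mulNmx mulmxN -vE mulmxA -/v => /eqP.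
by rewrite addr_eq0 opprK => /eqP e; rewrite -[LHS]opprK e.
Qed.

End IsotropicCurves.

(** * Distributions constant along their planes *)

Section NullDistributions.
Variables (R : realType) (m : nat).
Local Notation C := (Cplx R).
Local Notation n := (2 * m).+1.
Local Notation V := 'rV[C]_n.
Implicit Types (x y u v : V) (U O : set V) (N D : V -> {vspace V}).

Section LocalGraph.
Variables (P : 'M[C]_(n, m.+1)) (Q : 'M[C]_(n, m)).
Variables (B1 : 'M[C]_(m.+1, n)) (B2 : 'M[C]_(m, n)).
Hypothesis fr : dual_frame P Q B1 B2.

(** If nu is a frame of N written in columns, D is the kernel of right multiplication
by nu; near a point where the last block of nu is invertible, column operations
reduce nu to the normals of a graph. *)
Lemma local_graph U N x A : holomorphic_distribution U m N -> U x ->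
  ortho_dist N x = graphv P Q A ->
  exists O (B : V -> 'M[C]_(m.+1, m)),
    [/\ open O, O x, O `<=` U, C1_on O B & forall y, O y -> ortho_dist N y = graphv P Q (B y)].
Proof.
move=> [dN hN] Ux Dx; have [ O [X [oO Ox OU hX NX]]] := hN x Ux.
pose nu y : 'M[C]_(n, m) := \matrix_(j, i) X i y 0 j.
have NE y : O y -> forall v, (v \in N y) = (v <= (nu y)^T)%MS.
  move=> Oy v; rewrite NX // -mem_span_rows.
  congr (v \in span _); apply: eq_map => i.
  by apply/rowP => j; rewrite !mxE.
have DE y u : O y -> (u \in ortho_dist N y) = (u *m nu y == 0).
  by move=> Oy; rewrite /ortho_dist (perp_rows u (NE y Oy)) trmxK.
have C1nu : C1_on O nu.
  apply: (C1_mx oO) => j i.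
  apply: (@C1_eq C V C O (fun y => X i y 0 j : C) _ oO).
    by move=> y Oy; rewrite mxE.
  apply: (C1_entry _ _ oO); exact: (hX i).
have C1B r (B : 'M[C]_(r, n)) : C1_on O (fun y => B *m nu y).
  apply: (C1_mulmx oO); [exact: C1_cst | exact: C1nu].
pose O1 := [set y | O y /\ B2 *m nu y \in unitmx].
have oO1 : open O1 := open_C1_preimage oO (C1B _ B2) (@open_unitmx C m).
have O1O : O1 `<=` O by move=> y [].
exists O1, (fun y => - (B1 *m nu y *m invmx (B2 *m nu y))); split.
- exact: oO1.
- split => //.
  have e : nu x = normal P Q A *m (B2 *m nu x).
    apply: (annihilator_graph fr); apply/row_matrixP => i; rewrite row0 row_mul.
    by apply/eqP; rewrite -DE // Dx (graphvP fr) row_sub.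
  have rk : \rank (nu x) = m.
    by rewrite -mxrank_tr -(dim_row_space (NE x Ox)) dN.
  rewrite -row_full_unit /row_full eqn_leq rank_leq_row /=.
  by rewrite -{1}rk {1}e mxrankM_maxr.
- by move=> y /O1O/OU.
- apply: (C1N oO1); apply: (C1_mulmx oO1); first exact: C1_sub (C1B _ B1).
  by apply: (C1_invmx oO1); [move=> y [] | exact: C1_sub (C1B _ B2)].
- move=> y [y1 uy]; have Oy := y1; apply/vspaceP => u; rewrite DE // mem_graphv.
  rewrite -{1}(normal_of_columns fr uy) mulmxA.
  apply/eqP/eqP => [h|->]; last by rewrite mul0mx.
  by apply: (can_inj (mulmxK uy)); rewrite h mul0mx.
Qed.

(** The rows of [lift (A y)] are sections of D with constant first coordinates; their
derivatives along D have vanishing first coordinates and lie in D, hence vanish. *)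
Lemma graph_derivative0 U O N (A : V -> 'M[C]_(m.+1, m)) y v :
  totally_co_geodetic U N -> open O -> O `<=` U -> C1_on O A ->
  (forall y, O y -> ortho_dist N y = graphv P Q (A y)) ->
  O y -> v \in ortho_dist N y -> 'd A y v = 0.
Proof.
move=> cog oO OU hA DA Oy; rewrite DA // (graphvP fr) => /submxP[c vE].
pose X (e : 'rV[C]_m.+1) z := e *m lift B1 B2 (A z).
have sX e : local_section (ortho_dist N) O (X e).
  split; last by move=> z Oz; rewrite DA // (graphvP fr) submxMl.
  apply: (C1_mulmx oO); first exact: C1_cst.
  apply: (C1D oO); first exact: C1_cst.
  apply: (C1_mulmx oO); [exact: hA | exact: C1_cst].
have dA : differentiable A y by have [] := hA y Oy.
apply/row_matrixP => i; rewrite row0 rowE.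
pose e : 'rV[C]_m.+1 := delta_mx 0 i.
have := cog O (X e) (X c) oO OU (sX e) (sX c) y Oy.
have Xc : X c y = v by rewrite /X vE.
rewrite /nabla Xc DA // deriveE; last by have [] := (sX e).1 y Oy.
have [d1 e1] := diff_mulmxr B2 dA.
have d2 : differentiable (fun z => lift B1 B2 (A z)) y.
  exact: (differentiableD (differentiable_cst B1 y) d1).
have e2 : 'd (fun z => lift B1 B2 (A z)) y v = 'd A y v *m B2.
  apply: etrans (diffD_apply v (differentiable_cst B1 y) d1) _.
  exact: (etrans (f_equal2 +%R (diff_cst_apply B1 y v) (e1 v)) (add0r _)).
have [d3 e3] := diff_mulmxl e d2.
have E : 'd (X e) y v = e *m ('d A y v *m B2) := etrans (e3 v) (congr1 (mulmx e) e2).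
have [_ _ _ h3 h4] := fr.
have EP : e *m ('d A y v *m B2) *m P = 0 by rewrite -!mulmxA h3 !mulmx0.
have EQ : e *m ('d A y v *m B2) *m Q = e *m 'd A y v by rewrite -!mulmxA h4 mulmx1.
by rewrite E mem_graphvE EP EQ mul0mx => /eqP.
Qed.

(** Let z = y + v with v in D y.  On the segment, v differs from an element of D w by
a multiple of A y - A w, and the derivative of A kills D w; so the mean value
inequality bounds A z - A y by half of the largest variation of A on the segment
once r is small.  Iterating the bound gives zero. *)
Lemma graph_constant O D (A : V -> 'M[C]_(m.+1, m)) x0 :
  open O -> O x0 -> C1_on O A ->
  (forall y, O y -> D y = graphv P Q (A y)) ->
  (forall y v, O y -> v \in D y -> 'd A y v = 0) ->
  exists2 r : R, 0 < r & (forall y, nm (y - x0) < r -> O y) /\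
    forall y z, nm (y - x0) < r -> nm (z - x0) < r -> z - y \in D y -> D z = D y.
Proof.
move=> oO Ox0 hA DA dA0.
have [d1 d10 hd1] := C1_diff_close oO Ox0 hA ltr01.
have [k0 k00 hk0] := linear_bound ('d A x0).
pose k := k0 + 1.
have k_gt0 : 0 < k by rewrite addr_gt0.
have hk y w : nm (y - x0) < d1 -> nm ('d A y w) <= k * nm w.
  move=> /hd1[_ /(_ w) h1]; have h2 := hk0 w.
  have -> : 'd A y w = ('d A y w - 'd A x0 w) + 'd A x0 w by rewrite subrK.
  apply: le_trans (nmD _ _) _; rewrite /k mulrDl mul1r addrC.
  by apply: lerD => //; rewrite -[leRHS]mul1r.
pose M : R := n%:R * nm P * (m.+1)%:R * (m%:R * nm B2) + 1.
have M0 : 0 < M.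
  by rewrite ltr_wpDl // !mulr_ge0 ?nm_ge0 ?ler0n.
have hM v (X : 'M[C]_(m.+1, m)) : nm (v *m P *m X *m B2) <= M * (nm v * nm X).
  have h1 := nm_mulmx (v *m P *m X) B2.
  have h2 := nm_mulmx (v *m P) X.
  have h3 := nm_mulmx v P.
  apply: le_trans h1 _.
  apply: (@le_trans _ _ (m%:R * (m.+1%:R * (n%:R * (nm v * nm P) * nm X) * nm B2))).
    rewrite ler_wpM2l ?ler0n // ler_wpM2r ?nm_ge0 //.
    by apply: le_trans h2 _; rewrite ler_wpM2l ?ler0n // ler_wpM2r ?nm_ge0.
  rewrite /M mulrDl mul1r -[leLHS]addr0; apply: lerD; last by rewrite mulr_ge0 ?nm_ge0.
  move: (nm v) (nm P) (nm X) (nm B2) => a b c d.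
  by rewrite le_eqVlt; apply/orP; left; apply/eqP; ring.
have [d2 d20 hd2] : exists2 d2 : R, 0 < d2 & forall y, nm (y - x0) < d2 -> nm (A y - A x0) <= 1.
  have cA : {for x0, continuous A}.
    by apply: differentiable_continuous; have [] := hA x0 Ox0.
  have : nbhs (A x0) [set z | nm (z - A x0) <= 1].
    by apply/nbhs_nmP; exists 1 => // z /ltW.
  by move=> /cA/nbhs_nmP.
(* |v| <= 2 r, so 4 k M r <= 1 makes the contraction factor k M |v| at most 1/2. *)
pose r := Num.min (Num.min d1 d2) (4 * k * M)^-1.
have r0 : 0 < r.
  by rewrite /r !lt_min d10 d20 invr_gt0 !mulr_gt0.
have r1 : r <= d1 by rewrite /r !ge_min lexx.
have r2 : r <= d2 by rewrite /r !ge_min lexx orbT.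
have r3 : 4 * k * M * r <= 1.
  by rewrite mulrC -ler_pdivlMr ?mulr_gt0 // div1r /r ge_min lexx orbT.
exists r => //.
have rO y : nm (y - x0) < r -> O y by move=> yr; have [] := hd1 y (lt_le_trans yr r1).
split => // y z yr zr zy.
rewrite (DA y (rO y yr)) (DA z (rO z zr)).
congr graphv; apply/subr0_eq/nm_eq0/eqP; rewrite eq_le nm_ge0 andbT.
apply: (@small_geometric _ _ 2) => i.
elim: i z zr zy => [|i IH] z zr zy.
  have -> : A z - A y = (A z - A x0) - (A y - A x0) by rewrite opprB addrA subrK.
  rewrite expr0 divr1; apply: le_trans (nmB _ _) _; rewrite -[2]/(1 + 1).
  exact: lerD (hd2 _ (lt_le_trans zr r2)) (hd2 _ (lt_le_trans yr r2)).
have -> : z = y + (z - y) by rewrite addrC subrK.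
apply: mean_value_mx => t t01.
set w := y + _.
have wr : nm (w - x0) < r by apply: ball_segment.
have Ow := rO w wr.
have wy : w - y \in D y by rewrite /w addrC addKr memvZ.
split; first by have [] := hA w Ow.
have hw := IH w wr wy.
have e : 'd A w (z - y) = 'd A w ((z - y) *m P *m (A y - A w) *m B2).
  have vE : z - y = (z - y) *m P *m lift B1 B2 (A y).
    have /submxP[c cE] : ((z - y) <= lift B1 B2 (A y))%MS by rewrite -(graphvP fr) -(DA y (rO y yr)).
    by rewrite {2}cE -(mulmxA c) (lift_fst fr) mulmx1.
  have vE2 : z - y = (z - y) *m P *m lift B1 B2 (A w) + (z - y) *m P *m (A y - A w) *m B2.
    by rewrite {1}vE (lift_shift B1 B2 (A y) (A w)) mulmxDr mulmxA.
  have in_w : (z - y) *m P *m lift B1 B2 (A w) \in D w.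
    by rewrite (DA w Ow) (graphvP fr) submxMl.
  by rewrite [in LHS]vE2 (linearD ('d A w)) (dA0 w _ Ow in_w) add0r.
rewrite e; apply: le_trans (hk _ _ (lt_le_trans wr r1)) _.
apply: le_trans (ler_wpM2l (ltW k_gt0) (hM _ _)) _.
rewrite nm_distC in hw.
have zy2 : nm (z - y) <= 2 * r.
  have -> : z - y = (z - x0) - (y - x0) by rewrite opprB addrA subrK.
  by apply: le_trans (nmB _ _) _; rewrite mulrDl mul1r; apply: lerD; exact: ltW.
have -> : 2 / 2 ^+ i.+1 = 2 / 2 ^+ i / 2 :> R by rewrite exprS invfM mulrA mulrAC.
have q0 : 0 <= 2 / 2 ^+ i :> R by rewrite divr_ge0 // exprn_ge0.
apply: (@le_trans _ _ (k * (M * (2 * r * (2 / 2 ^+ i))))).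
  by rewrite !ler_pM2l // ler_pM ?nm_ge0.
move: (2 / 2 ^+ i) q0 => q q0.
have -> : k * (M * (2 * r * q)) = 4 * k * M * r * (q / 2) by field.
by rewrite -[leRHS]mul1r ler_wpM2r // divr_ge0.
Qed.

End LocalGraph.
End NullDistributions.

(** * Leaves *)

Section Leaves.
Variables (R : realType) (m : nat).
Local Notation C := (Cplx R).
Local Notation n := (2 * m).+1.
Local Notation V := 'rV[C]_n.
Implicit Types (x y z u v : V) (D : V -> {vspace V}).

Section Ball.
Variables (P : 'M[C]_(n, m.+1)) (Q : 'M[C]_(n, m)).
Variables (D : V -> {vspace V}) (A : V -> 'M[C]_(m.+1, m)) (x0 : V) (r : R).
Let U := [set y : V | nm (y - x0) < r].
Hypothesis hA : C1_on U A.
Hypothesis DA : forall y, U y -> D y = graphv P Q (A y).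
Hypothesis dA0 : forall y v, U y -> v \in D y -> 'd A y v = 0.
Hypothesis const : forall y z, U y -> U z -> z - y \in D y -> D z = D y.

(** Along an integral disc the derivative of A vanishes, so D is a fixed subspace
there, and a disc tangent to a fixed subspace stays in one of its translates. *)
Lemma integral_disc_plane y z : integral_disc U D y z ->
  [/\ U y, U z & z - y \in D y].
Proof.
move=> [a [rho [c [hc cU [s [t [bs bt cs ct]]]]]]].
have [Uy _] := cU s bs; have [Uz _] := cU t bt; rewrite cs in Uy; rewrite ct in Uz.
split => //.
have rho0 : 0 < rho.
  by apply: le_lt_trans (normr_ge0 (a - s)) _; move: bs; rewrite -ball_normE.
have rhoE : ((complex.Re (rho : R[i]))%:C : C) = rho.
  by apply: RRe_real; exact: gtr0_real.
have seg (w : C^o) (tau : R) : ball (a : C^o) rho w -> 0 <= tau <= 1 ->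
    ball (a : C^o) rho (s + (tau%:C : C) *: (w - s)).
  rewrite -rhoE => /ball_nm bw h; apply/ball_nm; apply: ball_segment => //.
  by apply/ball_nm; rewrite rhoE.
have dc w : ball (a : C^o) rho w -> differentiable c w by move=> bw; have [] := hc w bw.
have cD w (h : C) : ball (a : C^o) rho w -> 'd c w h \in D (c w).
  by move=> bw; rewrite diff_curve; [apply: memvZ; have [] := cU w bw | exact: dc].
have Ac w : ball (a : C^o) rho w -> A (c w) = A (c s).
  move=> bw; apply/subr0_eq/nm_eq0/eqP; rewrite eq_le nm_ge0 andbT.
  have -> : w = s + (w - s) by rewrite addrC subrK.
  apply: (mean_value_mx (f := fun h => A (c h))) => tau t01.
  set w' := s + _; have bw' : ball (a : C^o) rho w' by exact: seg.
  have [Uw _] := cU w' bw'.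
  have dA : differentiable A (c w') by have [] := hA Uw.
  split; first exact: (differentiable_comp (dc _ bw') dA).
  rewrite (_ : 'd _ w' (w - s) = 'd A (c w') ('d c w' (w - s))).
    by rewrite dA0 ?nm0 //; exact: cD.
  exact: (diff_comp_apply _ (dc _ bw') dA).
have Dc w : ball (a : C^o) rho w -> D (c w) = D (c s).
  move=> bw; have [Uw _] := cU w bw; have [Us _] := cU s bs.
  by rewrite (DA Uw) (DA Us) Ac.
rewrite (DA Uy) mem_graphv; set S := normal P Q (A y).
have : nm (c t *m S - c s *m S) <= 0.
  have {1}-> : t = s + (t - s) by rewrite addrC subrK.
  apply: (mean_value_mx (f := fun h => c h *m S)) => tau t01.
  set w' := s + _; have bw' : ball (a : C^o) rho w' by exact: seg.
  have [d1 e1] := diff_mulmxr S (dc _ bw'); split; first exact: d1.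
  rewrite (_ : 'd _ w' (t - s) = 'd c w' (t - s) *m S); last exact: e1.
  have /eqP : 'd c w' (t - s) *m S == 0.
    rewrite -mem_graphv -DA // -cs -(Dc w' bw'); exact: cD.
  by move=> ->; rewrite nm0.
rewrite cs ct -mulmxBl => h; apply/eqP/nm_eq0/eqP.
by rewrite eq_le h nm_ge0.
Qed.

(** A complex disc around a real segment need not fit into the ball, so the segment is
covered by a chain of small discs. *)
Lemma segment_leaf x y : U x -> U y -> y - x \in D x -> leaf U D x y.
Proof.
move=> Ux Uy yx; pose mx := Num.max (nm (x - x0)) (nm (y - x0)).
have mxr : mx < r by rewrite gt_max Ux.
(* Discs of radius 2 / (k + 1) around the subdivision points stay in the ball. *)
pose k := Num.truncn (2 * nm (y - x) / (r - mx)).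
have gap : 0 < r - mx by rewrite subr_gt0.
have hk : 2 * nm (y - x) < k.+1%:R * (r - mx).
  by rewrite -ltr_pdivrMr // truncnS_gt.
have k0 : 0 < k.+1%:R :> R by rewrite ltr0n.
pose c := fun t : C^o => x + t *: (y - x).
pose q (i : nat) : R := i%:R / k.+1%:R.
have cq i : (i <= k.+1)%N -> nm (c (q i)%:C - x0) <= mx.
  move=> ik; apply/ler_addgt0Pr => e e0; apply: ltW; apply: ball_segment.
  - by rewrite /q divr_ge0 ?ler0n //= ler_pdivrMr // mul1r ler_nat.
  - by rewrite ltr_pwDr // le_max lexx.
  - by rewrite ltr_pwDr // le_max lexx orbT.
have cU i t : (i <= k.+1)%N -> nm (t - (q i)%:C : C) < 2 / k.+1%:R -> U (c t).
  move=> ik tq; rewrite /U /=.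
  have -> : c t - x0 = (t - (q i)%:C) *: (y - x) + (c (q i)%:C - x0).
    by rewrite /c scalerBl addrA [x + _ *: _ in RHS]addrC addrA subrK [_ + x]addrC.
  apply: le_lt_trans (nmD _ _) _; rewrite nmZ.
  have h1 : nm (t - (q i)%:C : C) * nm (y - x) <= 2 / k.+1%:R * nm (y - x).
    by rewrite ler_wpM2r ?nm_ge0 // ltW.
  have h2 : 2 / k.+1%:R * nm (y - x) < r - mx by rewrite mulrAC ltr_pdivrMr // [ltRHS]mulrC.
  by apply: le_lt_trans (lerD h1 (cq i ik)) _; rewrite -ltrBrDr.
have cD t : U (c t) -> D (c t) = D x.
  by move=> Uc; apply: const => //; rewrite /c addrC addKr memvZ.
have H i : (i <= k.+1)%N -> leaf U D x (c (q i)%:C).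
  elim: i => [|i IH] ik.
    by rewrite /c /q mul0r scale0r addr0; exact: leaf_refl.
  apply: leaf_step (IH (ltnW ik)) _.
  exists (q i)%:C, (2 / k.+1%:R)%:C, c; split.
  - exact: C1_sub (fun _ _ => I) (C1_line x (y - x) openT).
  - move=> t /ball_nm bt; have Uc := cU i t (ltnW ik) bt; split => //.
    have [dc _] := @C1_line C V setT x (y - x) openT t I.
    by rewrite derive1E' // cD // diff_line scale1r.
  - exists (q i)%:C, (q i.+1)%:C; split => //; apply/ball_nm.
      by rewrite subrr nm0 divr_gt0.
    rewrite -rmorphB nm_real /q -mulrBl -natrB // subSnn mul1r ger0_norm ?invr_ge0 ?ltW //.
    by rewrite ltr_pMl ?invr_gt0 // ltr1n.
have := H k.+1 (leqnn _); rewrite /q divff ?gt_eqF // /c scale1r.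
by rewrite addrC subrK.
Qed.

(** Discs do not leave the plane, and segments of the plane are chains of discs. *)
Lemma leaf_plane x : U x -> leaf U D x = affine_subspace x (D x) `&` U.
Proof.
move=> Ux; apply/seteqP; split => [y|y [yx Uy]]; last exact: segment_leaf.
elim=> [|{}y z _ [yx Uy] /integral_disc_plane[_ Uz zy]].
  by split => //; exact: affine_subspace_refl.
split => //; move: zy; rewrite (const Ux Uy yx) => zy.
by have := memvD zy yx; rewrite addrA subrK.
Qed.

End Ball.
End Leaves.

(** * The family of planes of a distribution *)

Section PlaneFamily.
Variables (R : realType) (m : nat).
Local Notation C := (Cplx R).
Local Notation n := (2 * m).+1.
Local Notation V := 'rV[C]_n.
Variables (U : set V) (D : V -> {vspace V}).
Hypothesis oU : open U.
Hypothesis MT_D : forall x, U x -> MT (affine_subspace x (D x)).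
Hypothesis const : forall x y, U x -> U y -> y - x \in D x -> D y = D x.
Hypothesis loc : forall x (P : 'M[C]_(n, m.+1)) (Q : 'M[C]_(n, m)) A,
  U x -> chart P Q -> D x = graphv P Q A ->
  exists O (B : V -> 'M[C]_(m.+1, m)),
    [/\ open O, O x, O `<=` U, C1_on O B & forall y, O y -> D y = graphv P Q (B y)].

Let W : set (set V) := [set S | exists2 x, U x & S = affine_subspace x (D x)].

Lemma through_point x : U x ->
  W `&` planes_through x = [set affine_subspace x (D x)].
Proof.
move=> Ux; apply/seteqP; split => [S [[y Uy ->] [_ Sx]]|_ ->].
  by rewrite /= (const Uy Ux Sx); apply/esym/affine_subspace_eq.
split; first by exists x.
by split; [exact: MT_D | exact: affine_subspace_refl].
Qed.

(** Near M the family is the graph A' = alpha tau.  Indeed the plane of (A', b) passes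
through the point z tau of [U], and two planes of the family through the same point
coincide. *)
Lemma plane_submanifold : submanifold_of_MT m W.
Proof.
split=> [_ [x Ux ->]|P Q PQ M [x Ux e]]; first exact: MT_D.
have [B1 [B2 fr]] := chart_frame PQ.
have [h1 h2 h3 h4 h5] := fr.
have xM : chart_plane P Q M x by rewrite e; exact: affine_subspace_refl.
have Dx : D x = graphv P Q (usubmx M).
  by apply/esym; move: e; rewrite (chart_plane_affine xM); exact: affine_subspace_inj.
have [G [A [oO Ox OU hA DA]]] := loc Ux PQ Dx.
pose z (tau : 'rV[C]_m) : V := x *m P *m B1 + tau *m B2.
have zP tau : z tau *m P = x *m P.
  by rewrite /z mulmxDl -!mulmxA h2 h4 !mulmx0 addr0 mulmx1.
have zQ tau : z tau *m Q = tau.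
  by rewrite /z mulmxDl -!mulmxA h3 h5 !mulmx0 add0r mulmx1.
have zx : z (x *m Q) = x.
  by rewrite /z -!mulmxA -mulmxDr h1 mulmx1.
pose tau (M' : 'M[C]_(m.+1 + 1, m)) : 'rV[C]_m := row_mx (x *m P) 1%:M *m M'.
have tauE M' : tau M' = x *m P *m usubmx M' + dsubmx M'.
  by rewrite /tau -{1}[M']vsubmxK mul_row_col mul1mx.
have tauM : tau M = x *m Q by rewrite /tau -xM.
pose alpha t := A (z t).
have C1z (E : normedModType C) (O1 : set E) (f : E -> 'rV[C]_m) : open O1 -> C1_on O1 f -> C1_on O1 (fun y => z (f y)).
  move=> oO1 hf; apply: (C1D oO1); first exact: C1_cst.
  exact: (C1_mulmxr B2 oO1 hf).
pose OM := [set M' | G (z (tau M'))].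
pose Ow := [set w : 'M[C]_(m.+1 + 1, m) | G (z (dsubmx w))].
have C1tau O1 : open O1 -> C1_on O1 tau.
  by move=> oO1; exact: (C1_mulmxl _ oO1 (@C1_id C _ O1)).
have C1ds O1 : open O1 -> C1_on O1 (fun w : 'M[C]_(m.+1 + 1, m) => dsubmx w : 'rV[C]_m).
  by move=> oO1; exact: (C1_dsubmx oO1 (@C1_id C _ O1)).
have C1us O1 : open O1 -> C1_on O1 (fun w : 'M[C]_(m.+1 + 1, m) => usubmx w).
  by move=> oO1; exact: (C1_usubmx oO1 (@C1_id C _ O1)).
have oOM : open OM.
  have := open_C1_preimage openT (C1z _ _ _ openT (C1tau _ openT)) oO.
  by congr open; apply/funext => t; apply/propext; split => [[]|].
have oOw : open Ow.
  have := open_C1_preimage openT (C1z _ _ _ openT (C1ds _ openT)) oO.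
  by congr open; apply/funext => t; apply/propext; split => [[]|].
pose Phi M' := col_mx (usubmx M' - alpha (tau M')) (tau M').
pose lftA (w : 'M[C]_(m.+1 + 1, m)) := usubmx w + alpha (dsubmx w).
pose Psi w := col_mx (lftA w) (dsubmx w - x *m P *m lftA w).
pose F : {vspace 'M[C]_(m.+1 + 1, m)} := lker (linfun (mulmx (row_mx 1%:M 0 : 'M[C]_(m.+1, m.+1 + 1)))).
have memF w : (w \in F) = (usubmx w == 0).
  by rewrite memv_ker lfunE /= -usubmx_mul.
have C1alpha (O1 : set 'M[C]_(m.+1 + 1, m)) (f : 'M[C]_(m.+1 + 1, m) -> 'rV[C]_m) :
    open O1 -> C1_on O1 f -> (forall y, O1 y -> G (z (f y))) ->
    C1_on O1 (fun y => alpha (f y)).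
  move=> oO1 hf hG.
  exact: (@C1_comp C _ 1 n _ O1 G A (fun y => z (f y)) oO1 hG (C1z _ _ _ oO1 hf) hA).
have C1Phi : C1_on OM Phi.
  exact: (C1_col_mx oOM (C1B oOM (C1us _ oOM)
    (C1alpha _ _ oOM (C1tau _ oOM) (fun _ h => h))) (C1tau _ oOM)).
have C1Psi : C1_on Ow Psi.
  have hl : C1_on Ow lftA.
    exact: (C1D oOw (C1us _ oOw) (C1alpha _ _ oOw (C1ds _ oOw) (fun _ h => h))).
  exact: (C1_col_mx oOw hl (C1B oOw (C1ds _ oOw) (C1_mulmxl (x *m P) oOw hl))).
have dim_F : \dim F = m.
  pose us : 'Hom('M[C]_(m.+1 + 1, m), 'M[C]_(m.+1, m)) :=
    linfun (mulmx (row_mx 1%:M 0 : 'M[C]_(m.+1, m.+1 + 1))).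
  have us_onto : limg us = fullv.
    apply/vspaceP => A'; rewrite memvf; apply/idP.
    have -> : A' = us (col_mx A' 0) by rewrite lfunE /= -usubmx_mul col_mxKu.
    by apply: memv_img; exact: memvf.
  have := limg_ker_dim us fullv; rewrite capfv us_onto !dimvf /dim /=.
  have -> : ((m.+1 + 1) * m = m + m.+1 * m)%N by rewrite addn1 mulSn.
  by move=> /addIn.
exists OM, Ow, Phi, Psi, F; split; split.
- exact: oOM.
- by rewrite /OM /= tauM zx.
- exact: oOw.
- exact: C1Phi.
- exact: C1Psi.
- move=> M' hM'; split; first by rewrite /Ow /= /Phi col_mxKd.
  by rewrite /Psi /lftA /Phi col_mxKu col_mxKd subrK tauE addrC addKr vsubmxK.
- move=> w hw; have tw : tau (Psi w) = dsubmx w.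
    by rewrite tauE /Psi col_mxKu col_mxKd addrC subrK.
  split; first by rewrite /OM /= tw.
  by rewrite /Phi tw /Psi col_mxKu /lftA addrK vsubmxK.
- exact: dim_F.
- move=> M' hM'; rewrite memF /Phi col_mxKu subr_eq0.
  have zM : chart_plane P Q M' (z (tau M')) by rewrite /chart_plane /= zP zQ.
  have Uz : U (z (tau M')) by apply: OU.
  rewrite /in_chart /= (chart_plane_affine zM); split => [[y Uy e']|/eqP eM].
    have e2 := affine_subspace_inj e'.
    have : affine_subspace y (D y) (z (tau M')) by rewrite -e'; exact: affine_subspace_refl.
    move=> /(const Uy Uz); rewrite -e2 (DA _ hM') => /(graphv_inj fr) e3.
    by rewrite /alpha e3 eqxx.
  by exists (z (tau M')) => //; rewrite (DA _ hM') eM.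
Qed.

(** Split the velocity by its tau-component t': the first curve moves the base point
of the plane by t' inside the family, the second one keeps x and has the remaining
velocity, which satisfies the linearised isotropy equation. *)
Lemma plane_transverse x : U x ->
  transverse_at W (planes_through x) (affine_subspace x (D x)).
Proof.
move=> Ux P Q M PQ e v [ O0 [c [[oO0 O00 hc c0 cMT] cv]]].
have [B1 [B2 fr]] := chart_frame PQ.
have [h1 h2 h3 h4 h5] := fr.
have xM : chart_plane P Q M x by rewrite e; exact: affine_subspace_refl.
have Dx : D x = graphv P Q (usubmx M).
  by apply/esym; move: e; rewrite (chart_plane_affine xM); exact: affine_subspace_inj.
have [G [A [oG Gx GU hA DA]]] := loc Ux PQ Dx.
have ME : dsubmx M = x *m Q - x *m P *m usubmx M.
  move: xM; rewrite /chart_plane /= -{1}[M]vsubmxK mul_row_col mul1mx => ->.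
  by rewrite addrC addKr.
have Ax : A x = usubmx M.
  by apply: (graphv_inj fr); rewrite -Dx -DA.
pose a := usubmx v.
pose t' : 'rV[C]_m := x *m P *m a + dsubmx v.
have dc : differentiable c 0 by have [] := hc 0 O00.
have dv : 'd c 0 1 = v by rewrite -cv derive1E'.
(* The curve in W: the base point z t has the first coordinates of x. *)
pose z := fun t : C^o => x + t *: (t' *m B2).
pose O1 := [set t : C^o | G (z t)].
have C1z : C1_on setT z by exact: C1_line openT.
have oO1 : open O1.
  have := open_C1_preimage openT C1z oG.
  by congr open; apply/funext => t; apply/propext; split => [[]|].
have z0 : z 0 = x by rewrite /z scale0r addr0.
have O10 : O1 0 by rewrite /O1 /= z0.
have C1Az : C1_on O1 (fun t => A (z t)).
  exact: (@C1_comp C _ 1 n _ O1 G A z oO1 (fun _ h => h) (C1_sub (fun _ _ => I) C1z) hA).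
pose A1 := fun t : C^o => A (z t).
pose a1 := 'd A1 0 1.
have dA1 : differentiable A1 0 by have [] := C1Az 0 O10.
have A10 : A1 0 = usubmx M by rewrite /A1 z0.
have zP t : z t *m P = x *m P.
  by rewrite /z mulmxDl -scalemxAl -mulmxA h4 mulmx0 scaler0 addr0.
have zQ t : z t *m Q = x *m Q + t *: t'.
  by rewrite /z mulmxDl -scalemxAl -mulmxA h5 mulmx1.
have MTA1 t : O1 t -> MT (affine_subspace (z t) (graphv P Q (A1 t))).
  by move=> Gz; rewrite -(DA (z t) Gz); exact/MT_D/GU.
have nA1 t : O1 t -> (normal P Q (A1 t))^T *m normal P Q (A1 t) = 0.
  by move=> /MTA1/MT_affine[_ /(perp_graph_null fr)].
have sk1 := isotropic_velocity oO1 O10 dA1 nA1.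
pose c1 := fun t : C^o => col_mx (A1 t) (z t *m Q - z t *m P *m A1 t).
have c1E : c1 = fun t => col_mx (A1 t) ((x *m Q + t *: t') - x *m P *m A1 t).
  by apply/funext => t; rewrite /c1 zP zQ.
have cline : C1_on setT (fun t : C^o => x *m Q + t *: t') by exact: C1_line openT.
have C1c1 : C1_on O1 c1.
  rewrite c1E; apply: (C1_col_mx oO1 C1Az).
  exact: (C1B oO1 (C1_sub (fun _ _ => I) cline) (C1_mulmxl (x *m P) oO1 C1Az)).
have dc1 : 'd c1 0 1 = col_mx a1 (t' - x *m P *m a1).
  have dl : differentiable (fun t : C^o => x *m Q + t *: t') 0 by have [] := cline 0 I.
  have [d2 e2] := diff_mulmxl (x *m P) dA1.
  rewrite c1E; apply: etrans (diff_col_mx (1 : C^o) dA1 (differentiableB dl d2)) _.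
  congr col_mx; apply: etrans (diffB_apply (1 : C^o) dl d2) _.
  exact: (f_equal2 (fun a b => a - b) (etrans (diff_line _ _ _ _) (scale1r _)) (e2 1)).
(* The curve of planes through x, with the remaining velocity a - a1. *)
have dus : differentiable (fun t => usubmx (c t)) 0.
  by have [] := C1_usubmx oO0 hc O00.
have nc t : O0 t -> (normal P Q (usubmx (c t)))^T *m normal P Q (usubmx (c t)) = 0.
  by move=> /cMT/(chart_plane_MT _ PQ).
have := isotropic_velocity oO0 O00 dus nc.
rewrite (diff_usubmx (1 : C^o) dc) dv c0 -/a => sk.
pose N := normal P Q (usubmx M).
have NN : N^T *m N = 0 by have := nc 0 O00; rewrite c0.
have sk2 : (N^T *m P *m (a - a1))^T = - (N^T *m P *m (a - a1)).
  have sk1' : (N^T *m P *m a1)^T = - (N^T *m P *m a1) by move: sk1; rewrite /= A10.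
  have {}sk : (N^T *m P *m a)^T = - (N^T *m P *m a) := sk.
  rewrite mulmxBr; move: (N^T *m P *m a) (N^T *m P *m a1) sk sk1' => X Y eX eY.
  by rewrite linearB /= eX eY opprB opprK addrC.
have [ O2 [A2 [oO2 O20 C1A2 [A20 dA2] nA2]]] := isotropic_curve fr NN sk2.
pose c2 := fun t : C^o => col_mx (A2 t) (x *m Q - x *m P *m A2 t).
have C1c2 : C1_on O2 c2.
  apply: (C1_col_mx oO2 C1A2).
  exact: (C1B oO2 (@C1_cst C _ _ _ _) (C1_mulmxl (x *m P) oO2 C1A2)).
have dA2' : differentiable A2 0 by have [] := C1A2 0 O20.
have dc2 : 'd c2 0 1 = col_mx (a - a1) (- (x *m P *m (a - a1))).
  have [d2 e2] := diff_mulmxl (x *m P) dA2'.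
  have dk := @differentiable_cst C C^o _ (x *m Q) 0.
  apply: etrans (diff_col_mx (1 : C^o) dA2' (differentiableB dk d2)) _.
  rewrite dA2; congr col_mx; apply: etrans (diffB_apply (1 : C^o) dk d2) _.
  apply: etrans (f_equal2 (fun a b => a - b) (diff_cst_apply _ _ _) (e2 1)) _.
  by rewrite sub0r dA2.
exists ('d c1 0 1), ('d c2 0 1); split.
- exists O1, c1; split; last exact: (derive1E' (C1c1 0 O10).1).
  split; [exact: oO1 | exact: O10 | exact: C1c1 | | ].
  + by rewrite c1E A10 scale0r addr0 -ME vsubmxK.
  + move=> t O1t; rewrite /in_chart /= chart_planeE.
    by exists (z t); [exact: GU | rewrite (DA (z t) O1t)].
- exists O2, c2; split; last exact: (derive1E' (C1c2 0 O20).1).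
  split; [exact: oO2 | exact: O20 | exact: C1c2 | | ].
  + by rewrite /c2 A20 -ME vsubmxK.
  + move=> t O2t; rewrite /in_chart /= chart_planeE; split.
      apply/MT_affine; split; first exact: (dim_graphv fr).
      by apply/(perp_graph_null fr); exact: nA2.
    exact: affine_subspace_refl.
- apply: etrans _ (esym (f_equal2 +%R dc1 dc2)).
  rewrite add_col_mx -[LHS]vsubmxK -/a; congr col_mx; first by rewrite addrC subrK.
  rewrite mulmxBr opprB addrA subrK /t'.
  by rewrite [_ *m a + _]addrC addrK.
Qed.

Theorem plane_family_transverse : transverse_family U W.
Proof.
split; last 1 first.
- move=> x Ux; exists (affine_subspace x (D x)); split; first exact: through_point.
  exact: plane_transverse.
- move=> S [x Ux ->]; exists x => //; split; first exact: MT_D.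
  exact: affine_subspace_refl.
- exact: plane_submanifold.
Qed.

End PlaneFamily.

(** * From null structures to submanifolds *)

Section LeafFamily.
Variables (R : realType) (m : nat).
Local Notation C := (Cplx R).
Local Notation n := (2 * m).+1.
Local Notation V := 'rV[C]_n.
Implicit Types (U O : set V) (N : V -> {vspace V}) (S : set V).

(** An open piece of an affine subspace spans its direction. *)
Lemma plane_of_open_piece S x (T : {vspace V}) O O' :
  MT S -> open O -> O x -> open O' -> O' x -> \dim T = m.+1 ->
  affine_subspace x T `&` O' = S `&` O -> S = affine_subspace x T.
Proof.
move=> MS oO Ox oO' O'x dT e.
have [Sx _] : (S `&` O) x by rewrite -e; split => //; exact: affine_subspace_refl.
have [T' [SE dT' _]] := MT_through MS Sx; rewrite SE in e *.
congr affine_subspace; apply/eqP; rewrite eqEdim dT dT' leqnn andbT.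
apply/subvP => v vT'.
have /nbhs_nmP[eps eps0 heps] : nbhs x O by exact: open_nbhs_nbhs.
pose t := eps / (nm v + 1) / 2.
have v0 : 0 < nm v + 1 by rewrite ltr_wpDl ?nm_ge0.
have t0 : 0 < t by rewrite !divr_gt0.
have tC : (t%:C : C) != 0.
  by apply/eqP => /(@complexI R) t00; move: t0; rewrite t00 ltxx.
have : (affine_subspace x T' `&` O) (x + (t%:C : C) *: v).
  split; first by rewrite /affine_subspace /= addrC addKr memvZ.
  apply: heps; rewrite addrC addKr nmZ nm_real ger0_norm ?ltW //.
  apply: (@le_lt_trans _ _ (t * (nm v + 1))); first by rewrite ler_wpM2l ?lerDl // ltW.
  by rewrite /t mulrAC divfK ?gt_eqF // ltr_pdivrMr // ltr_pMr // ltr1n.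
rewrite -e => -[+ _]; rewrite /affine_subspace /= addrC addKr => h.
by have := memvZ (t%:C : C)^-1 h; rewrite scalerA mulVf // scale1r.
Qed.

Theorem leaf_family U N x0 :
  totally_co_geodetic_null_structure U N -> U x0 ->
  exists U',
    [/\ open U', U' x0, U' `<=` U,
        (forall x, U' x -> exists2 S, leaf_planes U' N S &
           open_piece (leaf U' (ortho_dist N) x) S)
      & transverse_family U' (leaf_planes U' N) /\ attached U' (leaf_planes U' N) N].
Proof.
move=> [[[hN nN] _] cog] Ux0; pose D := ortho_dist N.
have dD x : U x -> \dim (D x) = m.+1.
  by move=> Ux; rewrite dim_perp (hN.1 x Ux) dim_split addnK.
have [P [Q [PQ Dx0]]] := adapted_frame (dim_split m) (dD x0 Ux0).
have [B1 [B2 fr]] := chart_frame PQ.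
have [G [A [oG Gx0 GU hA DA]]] := local_graph fr hN Ux0 Dx0.
have dA0 y v : G y -> v \in D y -> 'd A y v = 0.
  exact: (graph_derivative0 fr cog oG GU hA DA).
have [r r0 [rG const]] := graph_constant fr oG Gx0 hA DA dA0.
pose U' := [set y : V | nm (y - x0) < r].
have oU' : open U' := open_nm_ball x0 r.
have U'x0 : U' x0 by rewrite /U' /= subrr nm0.
have U'U : U' `<=` U by move=> y /rG/GU.
have leafE x : U' x -> leaf U' D x = affine_subspace x (D x) `&` U'.
  apply: (leaf_plane (P := P) (Q := Q) (A := A)).
  - exact: C1_sub rG hA.
  - by move=> y /rG/DA.
  - by move=> y v /rG; exact: dA0.
  - exact: const.
have MT_D x : U' x -> MT (affine_subspace x (D x)).
  move=> /U'U Ux; apply/MT_affine; split; first exact: dD.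
  by rewrite /D /ortho_dist perpK; exact: nN.
have WE : leaf_planes U' N = [set S | exists2 x, U' x & S = affine_subspace x (D x)].
  apply/funext => S; apply/propext; split.
    move=> [MS [x U'x [ O [oO e]]]]; exists x => //.
    have lx : leaf U' D x x by exact: leaf_refl.
    have [_ Ox] : (S `&` O) x by rewrite -e.
    apply: (plane_of_open_piece MS oO Ox oU' U'x (dD x (U'U x U'x))).
    by rewrite -leafE.
  move=> [x U'x ->]; split; first exact: MT_D.
  by exists x => //; exists U'; split => //; exact: leafE.
exists U'; split => //.
  move=> x U'x; exists (affine_subspace x (D x)); first by rewrite WE; exists x.
  by exists U'; split => //; exact: leafE.
rewrite WE; split; last first.
  move=> x S U'x [y U'y ->] xy.
  by rewrite (const y x U'y U'x xy); apply/esym/affine_subspace_eq.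
apply: plane_family_transverse => // x P' Q' A' U'x P'Q' Dx.
have [B1' [B2' fr']] := chart_frame P'Q'.
have [G' [A'' [oG' G'x G'U hA' DA']]] := local_graph fr' hN (U'U x U'x) Dx.
exists (G' `&` U'), A''; split.
- exact: openI.
- by [].
- by move=> y [].
- by apply: C1_sub hA' => y [].
- by move=> y [G'y _]; exact: DA'.
Qed.

End LeafFamily.

(** * From submanifolds to null structures *)

Section AttachedStructure.
Variables (R : realType) (m : nat).
Local Notation C := (Cplx R).
Local Notation n := (2 * m).+1.
Local Notation V := 'rV[C]_n.
Local Notation M := 'M[C]_(m.+1 + 1, m).
Variables (U : set V) (W : set (set V)) (T : V -> {vspace V}).
Hypothesis oU : open U.
Hypothesis sub_W : submanifold_of_MT m W.
Hypothesis WT : forall x, U x -> W (affine_subspace x (T x)).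
Hypothesis WT_unique : forall x S, U x -> W S -> S x -> S = affine_subspace x (T x).
Hypothesis transT : forall x, U x ->
  transverse_at W (planes_through x) (affine_subspace x (T x)).

Let MT_T x : U x -> \dim (T x) = m.+1 /\ totally_null (perp (T x)).
Proof. by move=> Ux; apply/(@MT_affine R m x); apply: sub_W.1; exact: WT. Qed.

(** Translating the plane by t is a curve in the mini-twistor space.  By transversality
its velocity is the sum of a velocity in the family and of one along planes through
x0, and the latter does not change the incidence residual. *)
Lemma incidence_onto x0 P Q (M0 : M) (O O' : set M) (Phi Psi : M -> M) (F : {vspace M}) :
  U x0 -> chart P Q -> chart_plane P Q M0 = affine_subspace x0 (T x0) ->
  open O -> O M0 -> C1_on O Phi -> C1_on O' Psi ->
  (forall z, O z -> O' (Phi z) /\ Psi (Phi z) = z) ->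
  (forall z, O z -> (in_chart P Q W z <-> Phi z \in F)) ->
  forall t : 'rV[C]_m, exists2 f, f \in F &
    row_mx (x0 *m P) 1%:M *m 'd Psi (Phi M0) f = t.
Proof.
move=> Ux0 PQ M0E oO OM0 hPhi hPsi PhiK WF t.
set E := row_mx _ _.
have x0M : chart_plane P Q M0 x0 by rewrite M0E; exact: affine_subspace_refl.
pose c := fun s : C^o => M0 + s *: (col_mx 0 t : M).
have tv : tangent_vectors (in_chart P Q (@MT R m)) M0 (col_mx 0 t).
  have C1c : C1_on setT c by exact: C1_line openT.
  exists setT, c; split.
    split; [exact: openT | by [] | exact: C1c | by rewrite /c scale0r addr0 |].
    move=> s _; apply/(chart_plane_MT _ PQ).
    have -> : usubmx (c s) = usubmx M0.
      by rewrite /c linearD linearZ /= col_mxKu scaler0 addr0.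
    by apply/(chart_plane_MT _ PQ); rewrite M0E; apply: sub_W.1; exact: WT.
  apply: etrans (derive1E' (C1c 0 I).1) _.
  exact: etrans (diff_line _ _ _ _) (scale1r _).
have [v1 [v2 [tv1 tv2 vE]]] := transT Ux0 PQ M0E tv.
have Ev2 : E *m v2 = 0.
  have [ O2 [c2 [[oO2 O20 hc2 c20 c2x] c2v]]] := tv2.
  have dc2 := (hc2 0 O20).1.
  rewrite -c2v derive1E' // -(diff_mulmxl E dc2).2.
  have e s : O2 s -> x0 *m Q = E *m c2 s by move=> /c2x[].
  have := eq_on_diff (1 : C^o) oO2 O20 e (differentiable_cst (x0 *m Q) 0).
  by move=> ->; exact: diff_cst_apply.
have [ O1 [c1 [[oO1 O10 hc1 c10 c1W] c1v]]] := tv1.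
pose O3 := [set s | O1 s /\ O (c1 s)].
have oO3 : open O3 := open_C1_preimage oO1 hc1 oO.
have O30 : O3 0 by split => //; rewrite c10.
have dc1 : differentiable c1 0 := (hc1 0 O10).1.
have dPhi : differentiable Phi (c1 0) by rewrite c10; have [] := hPhi M0 OM0.
have dPsi : differentiable Psi (Phi (c1 0)).
  by rewrite c10; have [] := hPsi _ (PhiK M0 OM0).1.
have dPc : differentiable (fun s => Phi (c1 s)) 0 := differentiable_comp dc1 dPhi.
pose f := 'd (fun s => Phi (c1 s)) 0 1.
have fF : f \in F.
  apply: (velocity_in_subspace oO3 O30 dPc) => s [s1 Os].
  by apply/WF => //; exact: c1W.
exists f => //.
have -> : 'd Psi (Phi M0) f = v1.
  have eA : 'd (fun s => Psi (Phi (c1 s))) 0 1 = 'd Psi (Phi (c1 0)) f.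
    exact: (diff_comp_apply (1 : C^o) dPc dPsi).
  have e s : O3 s -> c1 s = Psi (Phi (c1 s)) by move=> [_ /PhiK[]].
  have eB := eq_on_diff (1 : C^o) oO3 O30 e dc1.
  have eC : 'd Psi (Phi (c1 0)) f = 'd Psi (Phi M0) f.
    exact: (congr1 (fun z => 'd Psi (Phi z) f) c10).
  exact: (etrans (esym eC) (etrans (esym eA) (etrans eB (etrans (esym (derive1E' dc1)) c1v)))).
have -> : v1 = col_mx 0 t - v2 by rewrite vE addrK.
by rewrite mulmxBr Ev2 subr0 mul_row_col mulmx0 add0r mul1mx.
Qed.

(** Solve the incidence equation for the parameter p of the family by inverting
(x, p) |-> (x, x P A p + b p - x Q) at (x, 0). *)
Lemma family_graph x0 : U x0 ->
  exists P Q G (A : V -> 'M[C]_(m.+1, m)),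
    [/\ chart P Q, open G, G x0 & G `<=` U] /\
    (C1_on G A /\ forall x, G x -> T x = graphv P Q (A x)).
Proof.
move=> Ux0; have [P [Q [PQ T0]]] := adapted_frame (dim_split m) (MT_T Ux0).1.
have {}PQ : chart P Q := PQ.
pose M0 : M := col_mx 0 (x0 *m Q - x0 *m P *m 0).
have M0E : chart_plane P Q M0 = affine_subspace x0 (T x0) by rewrite chart_planeE -T0.
have x0M : chart_plane P Q M0 x0 by rewrite M0E; exact: affine_subspace_refl.
have WM0 : in_chart P Q W M0 by rewrite /in_chart /= M0E; exact: WT.
have [ O [ O' [Phi [Psi [F [[oO OM0 oO' hPhi hPsi] [PhiK PsiK dimF WF]]]]]]] :=
  sub_W.2 P Q PQ M0 WM0.
have PM0 : O' (Phi M0) := (PhiK M0 OM0).1.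
have FM0 : Phi M0 \in F by apply/WF.
pose Lf (p : 'rV[C]_m) : M := \sum_i p 0 i *: (vbasis F)`_i.
have Llin : linear Lf.
  move=> a p q; rewrite /Lf scaler_sumr -big_split; apply: eq_bigr => i _.
  by rewrite !mxE scalerDl scalerA.
pose LM := GRing.isLinear.Build _ _ _ _ _ Llin.
pose L : {linear 'rV[C]_m -> M} := HB.pack Lf LM.
have LF p : L p \in F.
  apply: memv_suml => i _; apply: memvZ; apply: vbasis_mem.
  by rewrite mem_nth // size_tuple dimF.
have Lonto f : f \in F -> exists p, L p = f.
  move=> /coord_vbasis fE.
  have cast (k : nat) (s : seq M) : k = m ->
      (exists p : 'rV[C]_k, f = \sum_i p 0 i *: s`_i) ->
      exists p : 'rV[C]_m, \sum_i p 0 i *: s`_i = f.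
    by move=> -> [p ->]; exists p.
  apply: (cast _ (vbasis F) dimF); exists (\row_i coord (vbasis F) i f).
  by rewrite {1}fE; apply: eq_bigr => i _; rewrite mxE.
pose E0 := row_mx (x0 *m P) (1%:M : 'M[C]_1).
pose J : {linear 'rV[C]_m -> 'rV[C]_m} := mulmx E0 \o ('d Psi (Phi M0) \o L).
have Jinj : forall p, J p = 0 -> p = 0.
  apply: onto_injective => t.
  have [f /Lonto[p <-] <-] := incidence_onto Ux0 PQ M0E oO OM0 hPhi hPsi PhiK WF t.
  by exists p.
pose N := (n + m)%N.
pose q := fun y : 'rV[C]_N => Phi M0 + L (rsubmx y).
pose f := fun y : 'rV[C]_N => row_mx (lsubmx y)
  (row_mx (lsubmx y *m P) (1%:M : 'M[C]_1) *m Psi (q y) - lsubmx y *m Q).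
have C1q : C1_on setT q.
  apply: (C1D openT); first exact: C1_cst.
  apply: (@C1_comp C _ 1 m M setT setT L (fun y : 'rV[C]_N => rsubmx y) openT (fun _ _ => I)).
    exact: (C1_rsubmx openT (@C1_id C _ setT)).
  exact: C1_linear_mx.
pose Of := [set y | O' (q y)].
have oOf : open Of.
  have := open_C1_preimage openT C1q oO'.
  by congr open; apply/funext => t; apply/propext; split => [[]|].
have C1l : C1_on Of (fun y : 'rV[C]_N => lsubmx y : V).
  exact: (C1_lsubmx oOf (@C1_id C _ Of)).
have C1Psi : C1_on Of (fun y => Psi (q y)).
  exact: (@C1_comp C _ _ _ _ Of O' Psi q oOf (fun _ h => h) (C1_sub (fun _ _ => I) C1q) hPsi).
have C1f : C1_on Of f.
  apply: (C1_row_mx oOf C1l).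
  refine (C1B oOf (C1_mulmx oOf (C1_row_mx oOf (C1_mulmxr P oOf C1l) _) C1Psi) (C1_mulmxr Q oOf C1l)).
  exact: C1_cst.
pose a : 'rV[C]_N := row_mx x0 0.
have qa : q a = Phi M0 by rewrite /q /a row_mxKr linear0 addr0.
have Ofa : Of a by rewrite /Of /= qa.
have fa : f a = row_mx x0 0.
  rewrite /f qa (PhiK M0 OM0).2 /a row_mxKl; congr row_mx.
  by apply/eqP; rewrite subr_eq0; apply/eqP/esym; exact: x0M.
have df : differentiable f a := (C1f a Ofa).1.
have finj v : 'd f a v = 0 -> v = 0.
  move=> v0.
  have lv : lsubmx v = 0.
    have e1 := diff_lsubmx v df.
    have e2 := diff_lsubmx v (differentiable_idfun a).
    have e3 : (fun y => lsubmx (f y)) = (fun y : 'rV[C]_N => lsubmx y).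
      by apply/funext => y; rewrite /f row_mxKl.
    have e4 : lsubmx ('d (fun y : 'rV[C]_N => y) a v) = lsubmx v.
      by congr lsubmx; exact: diff_id_apply.
    rewrite -e4 -e2 -e3 e1 v0; exact: linear0.
  have vE : v = row_mx 0 (rsubmx v) by rewrite -lv hsubmxK.
  (* v only moves the parameter: differentiate f along the line a + t v. *)
  suff rv : rsubmx v = 0 by rewrite vE rv row_mx0.
  apply: Jinj.
  pose s := fun t : C^o => a + t *: v.
  pose l := fun t : C^o => Phi M0 + t *: L (rsubmx v).
  have s0 : s 0 = a by rewrite /s scale0r addr0.
  have l0 : l 0 = Phi M0 by rewrite /l scale0r addr0.
  have ds : differentiable s 0 := (@C1_line C _ setT a v openT 0 I).1.
  have dl : differentiable l 0 := (@C1_line C _ setT (Phi M0) (L (rsubmx v)) openT 0 I).1.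
  have dfs : differentiable f (s 0) by rewrite s0.
  have dPl : differentiable Psi (l 0) by rewrite l0; have [] := hPsi _ PM0.
  have dfc : differentiable (fun t => f (s t)) 0 := differentiable_comp ds dfs.
  have dPc : differentiable (fun t => Psi (l t)) 0 := differentiable_comp dl dPl.
  have es : 'd s 0 1 = v := etrans (diff_line _ _ _ _) (scale1r _).
  have el : 'd l 0 1 = L (rsubmx v) := etrans (diff_line _ _ _ _) (scale1r _).
  have efs : 'd (fun t => f (s t)) 0 1 = 0.
    apply: etrans (diff_comp_apply (1 : C^o) ds dfs) _.
    by rewrite es -[RHS]v0; exact: (congr1 (fun z => 'd f z v) s0).
  have ePl : 'd (fun t => Psi (l t)) 0 1 = 'd Psi (Phi M0) (L (rsubmx v)).
    apply: etrans (diff_comp_apply (1 : C^o) dl dPl) _.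
    by rewrite el; exact: (congr1 (fun z => 'd Psi z (L (rsubmx v))) l0).
  have [dE eE] := diff_mulmxl E0 dPc.
  have rE : (fun t => rsubmx (f (s t))) = fun t => E0 *m Psi (l t) - x0 *m Q.
    apply/funext => t; rewrite /f row_mxKr.
    have -> : lsubmx (s t) = x0.
      by rewrite /s linearD linearZ /= lv scaler0 addr0 /a row_mxKl.
    congr (_ *m Psi _ - _); rewrite /q /l; congr (_ + _).
    have -> : rsubmx (s t) = t *: rsubmx v.
      by rewrite /s linearD linearZ /= /a row_mxKr add0r.
    by rewrite linearZ.
  have e1 := diff_rsubmx (1 : C^o) dfc.
  have e2 := diffB_apply (1 : C^o) dE (differentiable_cst (x0 *m Q) 0).
  have e3 : E0 *m 'd Psi (Phi M0) (L (rsubmx v)) = 'd (fun t => rsubmx (f (s t))) 0 1.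
    rewrite rE; apply: etrans _ (esym e2).
    apply: etrans _ (esym (f_equal2 (fun u w => u - w) (eE 1) (diff_cst_apply _ _ _))).
    by rewrite subr0 ePl.
  rewrite [LHS]e3 e1 efs; exact: linear0.
have [ O2 [h [oO2 O2a C1h hO2]]] := local_right_inverse oOf Ofa C1f finj.
have C1i (S : set V) : open S -> C1_on S (fun x => row_mx x 0 : 'rV[C]_N).
  move=> oS; apply: (C1_row_mx oS (@C1_id C _ S)); exact: C1_cst.
pose G := [set x | U x /\ O2 (row_mx x 0)].
have oG : open G := open_C1_preimage oU (C1i U oU) oO2.
have GO2 x : G x -> O2 (row_mx x 0) by case.
have C1h' : C1_on G (fun x => h (row_mx x 0)).
  exact: (@C1_comp C _ 1 N _ G O2 h (fun x => row_mx x 0) oG GO2 (C1i G oG) C1h).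
have hOf x : G x -> Of (h (row_mx x 0)) by move=> /GO2/hO2[].
have C1M : C1_on G (fun x => Psi (q (h (row_mx x 0)))).
  exact: (@C1_comp C _ 1 N _ G Of (fun y => Psi (q y)) (fun x => h (row_mx x 0)) oG hOf C1h' C1Psi).
exists P, Q, G, (fun x => usubmx (Psi (q (h (row_mx x 0))))); split.
  by split => //; [split => //; rewrite -fa | move=> x []].
split; first exact: (C1_usubmx oG C1M).
move=> x Gx; have [_ fh] := hO2 _ (GO2 x Gx); set y := h _ in fh *.
have lx : lsubmx y = x by rewrite -[RHS](row_mxKl x (0 : 'rV[C]_m)) -fh /f row_mxKl.
have xM : chart_plane P Q (Psi (q y)) x.
  have : rsubmx (f y) = 0 by rewrite fh row_mxKr.
  by rewrite /f row_mxKr lx => /subr0_eq.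
have Oq : O' (q y) := hOf x Gx.
have WM : W (chart_plane P Q (Psi (q y))).
  apply/WF; first by have [] := PsiK _ Oq.
  by rewrite (PsiK _ Oq).2; apply: memvD.
have Ux : U x by case: Gx.
apply: (@affine_subspace_inj R m x x).
by rewrite -(WT_unique Ux WM xM) (chart_plane_affine xM).
Qed.

Let T_constant x y : U x -> U y -> y - x \in T x -> T y = T x.
Proof.
move=> Ux Uy yx; apply: (@affine_subspace_inj R m y x).
by apply/esym/(WT_unique Uy (WT Ux)).
Qed.

(** Along the line x + t v the section takes its values in the fixed space [E x]. *)
Lemma derivative_along_plane (E : V -> {vspace V}) O X x v :
  (forall x y, U x -> U y -> y - x \in T x -> E y = E x) ->
  open O -> O `<=` U -> local_section E O X -> O x -> v \in T x ->
  'D_v X x \in E x.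
Proof.
move=> Econst oO OU [hX XE] Ox vT.
pose s := fun t : C^o => x + t *: v.
have C1s : C1_on setT s by exact: C1_line openT.
pose O1 := [set t | True /\ O (s t)].
have oO1 : open O1 := open_C1_preimage openT C1s oO.
have s0 : s 0 = x by rewrite /s scale0r addr0.
have O10 : O1 0 by split => //; rewrite s0.
have ds : differentiable s 0 := (C1s 0 I).1.
have dX : differentiable X (s 0) by rewrite s0; have [] := hX x Ox.
have dXs : differentiable (fun t => X (s t)) 0 := differentiable_comp ds dX.
have es : 'd s 0 1 = v := etrans (diff_line _ _ _ _) (scale1r _).
have -> : 'D_v X x = 'd (fun t => X (s t)) 0 1.
  rewrite deriveE; last by have [] := hX x Ox.
  apply: etrans _ (esym (diff_comp_apply (1 : C^o) ds dX)).
  by rewrite es; exact: (congr1 (fun z => 'd X z v) (esym s0)).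
apply: (velocity_in_subspace oO1 O10 dXs) => t [_ Ot].
rewrite -(Econst x (s t) (OU _ Ox) (OU _ Ot)); first exact: XE.
by rewrite /s addrC addKr memvZ.
Qed.

(** Both T and its orthogonal complement are constant along the planes, and the latter
is contained in T because it is null. *)
Theorem attached_structure :
  totally_co_geodetic_null_structure U (fun x => perp (T x)).
Proof.
have nullT x : U x -> totally_null (perp (T x)) by move=> /MT_T[].
have sub_perp x v : U x -> v \in perp (T x) -> v \in T x.
  move=> Ux vp; rewrite -(perpK (T x)); apply/perpP => u up.
  exact: (nullT x Ux v u vp up).
have dual : ortho_dist (fun x => perp (T x)) = T.
  by apply/funext => x; rewrite /ortho_dist perpK.
split; [split; [split; [split|]|]|].
- by move=> x Ux; rewrite dim_perp (MT_T Ux).1 dim_split addKn.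
- move=> x Ux; have [P [Q [G [A [[PQ oG Gx GU] [C1A TA]]]]]] := family_graph Ux.
  have [B1 [B2 fr]] := chart_frame PQ.
  exists G, (fun i y => row i (normal P Q (A y))^T).
  split; [exact: oG | exact: Gx | exact: GU | | ].
    move=> i; apply: (C1_mx oG) => k j.
    have C1n : C1_on G (fun y => normal P Q (A y)).
      exact: (C1B oG (@C1_cst C V _ G Q) (C1_mulmxl P oG C1A)).
    apply: (@C1_eq C V C G (fun y => normal P Q (A y) j i : C) _ oG).
      by move=> y _; rewrite !mxE.
    exact: (C1_entry j i oG C1n).
  move=> y Gy; apply/vspaceP => u.
  by rewrite (TA y Gy) (perp_graph fr) mem_span_rows.
- exact: nullT.
- move=> O X Y oO OU sX sY x Ox; have Ux := OU x Ox.
  have Nconst y z : U y -> U z -> z - y \in T y -> perp (T z) = perp (T y).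
    by move=> Uy Uz /(T_constant Uy Uz) ->.
  apply: memvB; apply: (derivative_along_plane Nconst oO OU) => //.
    exact/(sub_perp _ _ Ux)/sX.2.
  exact/(sub_perp _ _ Ux)/sY.2.
- move=> O X Y oO OU; rewrite dual => sX sY x Ox.
  by apply: (derivative_along_plane T_constant oO OU) => //; exact: sY.2.
Qed.

End AttachedStructure.

(** * The correspondence *)

Theorem theorem3p8 (R : realType) (m : nat) (U : set 'rV[Cplx R]_(2 * m).+1)
    (m_ge1 : (1 <= m)%N) (U_open : open U) :
  [/\ (forall N : 'rV[Cplx R]_(2 * m).+1 -> {vspace 'rV[Cplx R]_(2 * m).+1},
         totally_co_geodetic_null_structure U N ->
         forall x0, U x0 ->
         exists U' : set 'rV[Cplx R]_(2 * m).+1,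
           [/\ open U', U' x0, U' `<=` U,
               (forall x, U' x -> exists2 S, leaf_planes U' N S &
                  open_piece (leaf U' (ortho_dist N) x) S)
             & transverse_family U' (leaf_planes U' N)]),
      (forall W : set (set 'rV[Cplx R]_(2 * m).+1),
         transverse_family U W ->
         exists N : 'rV[Cplx R]_(2 * m).+1 -> {vspace 'rV[Cplx R]_(2 * m).+1},
           attached U W N /\ totally_co_geodetic_null_structure U N)
    & (forall N : 'rV[Cplx R]_(2 * m).+1 -> {vspace 'rV[Cplx R]_(2 * m).+1},
         totally_co_geodetic_null_structure U N ->
         forall x0, U x0 ->
         exists (U' : set 'rV[Cplx R]_(2 * m).+1)
                (W : set (set 'rV[Cplx R]_(2 * m).+1)),
           [/\ open U', U' x0, U' `<=` U, transverse_family U' W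
             & attached U' W N])].
Proof.
split=> [N hN x0 Ux0|W [WU sub_W hW]|N hN x0 Ux0].
- by have [U' [oU' U'x0 U'U lf [tr _]]] := leaf_family hN Ux0; exists U'; split.
- have exT x : exists T, U x ->
      W `&` planes_through x = [set affine_subspace x T] /\
      transverse_at W (planes_through x) (affine_subspace x T).
    have [Ux|nUx] := pselect (U x); last by exists 0%VS.
    have [S [eS tS]] := hW x Ux.
    have [_ [MS Sx]] : (W `&` planes_through x) S by rewrite eS.
    by have [T [SE _ _]] := MT_through MS Sx; exists T => _; rewrite -SE.
  have [T hT] := choice exT.
  have WT x : U x -> W (affine_subspace x (T x)).
    move=> /hT[e _]; have [] : (W `&` planes_through x) (affine_subspace x (T x)) by rewrite e.
    by [].
  have WT_unique x S : U x -> W S -> S x -> S = affine_subspace x (T x).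
    move=> /hT[e _] WS Sx.
    have : (W `&` planes_through x) S by split => //; split => //; exact: sub_W.1.
    by rewrite e.
  exists (fun x => perp (T x)); split.
    by move=> x S Ux WS Sx; rewrite /ortho_dist perpK; exact: WT_unique.
  apply: (attached_structure U_open sub_W WT WT_unique) => x Ux.
  exact: (hT x Ux).2.
- have [U' [oU' U'x0 U'U _ [tr at_]]] := leaf_family hN Ux0.
  by exists U', (leaf_planes U' N); split.
Qed.
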